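(* Let $a_0, a_1, a_2 \in \mathbb{R}$, let $\tau_1, \tau_2 \in (0,+\infty)$ with $0 < \tau_1 < \tau_2$, and let $s_0 \in \mathbb{R}$. Consider the delay-differential equation $$y'(t) + a_0 y(t) + a_1 y(t-\tau_1) + a_2 y(t-\tau_2) = 0$$ and its characteristic function $\Delta : \mathbb{C} \to \mathbb{C}$, $\Delta(s) = s + a_0 + a_1 e^{-s\tau_1} + a_2 e^{-s\tau_2}$, and assume that $\frac{\tau_1}{\tau_2} \in (0, \frac{2}{3}]$. If $s_0$ is a root of $\Delta$ of (maximal) multiplicity $3$, then $s_0$ is a strictly dominant root of $\Delta$. In particular, if $s_0 < 0$, then the delay-differential equation is exponentially stable.
   Context: A real root $s_0$ of a function $\Delta : \mathbb{C} \to \mathbb{C}$ is called strictly dominant if every $s \in \mathbb{C}$ with $\Delta(s) = 0$ satisfies $s = s_0$ or $\operatorname{Re} s < s_0$. The multiplicity of any root of $\Delta(s) = s + a_0 + a_1 e^{-s\tau_1} + a_2 e^{-s\tau_2}$ is at most $3$, hence multiplicity $3$ is called maximal. The delay-differential equation is exponentially stable if there exist $C, \gamma > 0$ such that every solution $y$ with continuous initial condition $\varphi : [-\tau_2, 0] \to \mathbb{R}$ satisfies $|y(t)| \le C e^{-\gamma t} \sup_{[-\tau_2,0]} |\varphi|$ for all $t \ge 0$; it is a classical fact that this holds if and only if all roots of $\Delta$ have negative real part. *)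

(* Defs.v *)
From mathcomp Require Import all_boot all_order all_algebra.
From mathcomp Require Import complex.
From mathcomp Require Import all_classical all_reals all_analysis.
Import Order.TTheory GRing.Theory Num.Theory.
Import numFieldNormedType.Exports.

Set Implicit Arguments.
Unset Strict Implicit.
Unset Printing Implicit Defensive.

Local Open Scope classical_set_scope.
Local Open Scope ring_scope.
Local Open Scope complex_scope.

Definition cexp (R : realType) (z : R[i]) : R[i] :=
  (expR (complex.Re z))%:C * (cos (complex.Im z) +i* sin (complex.Im z)).

Definition charfun (R : realType) (a0 a1 a2 tau1 tau2 : R) (s : R[i]) : R[i] :=
  s + a0%:C + a1%:C * cexp (- s * tau1%:C) + a2%:C * cexp (- s * tau2%:C).

(* Meant for f differentiable in a neighbourhood of z as often as needed (for
   K = R[i]: f holomorphic near z). The derivatives are those over K itself, so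
   for K = R[i] they are complex derivatives. *)
Definition root_multiplicity (K : numFieldType) (f : K -> K) (z : K) (m : nat) :=
  (forall k : nat, (k < m)%N -> derive1n k f z = 0) /\ derive1n m f z <> 0.

Definition strictly_dominant (R : realType) (f : R[i] -> R[i]) (s0 : R) :=
  f s0%:C = 0 /\ forall s : R[i], f s = 0 -> s = s0%:C \/ complex.Re s < s0.

(* Only the values of phi on [- tau2, 0] and of y on [- tau2, +oo[ matter. *)
Definition dde_solution (R : realType) (a0 a1 a2 tau1 tau2 : R)
    (phi y : R -> R) :=
  [/\ {within `[- tau2, +oo[, continuous y},
      forall t : R, - tau2 <= t <= 0 -> y t = phi t &
      forall t : R, 0 < t -> derivable y t 1 /\
        derive1 y t + a0 * y t + a1 * y (t - tau1) + a2 * y (t - tau2) = 0].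

Definition exponentially_stable (R : realType) (a0 a1 a2 tau1 tau2 : R) :=
  exists C gamma : R, [/\ 0 < C, 0 < gamma &
    forall phi y : R -> R,
      {within `[- tau2, 0], continuous phi} ->
      dde_solution a0 a1 a2 tau1 tau2 phi y ->
      forall t : R, 0 <= t ->
        `|y t| <= C * expR (- gamma * t) *
                  sup [set `|phi x| | x in `[- tau2, 0]]].

(* Main.v *)
Require Import Defs.
From mathcomp Require Import all_boot all_order all_algebra all_field.
From mathcomp Require Import complex.
From mathcomp Require Import all_classical all_reals all_analysis.
From mathcomp Require Import ring lra zify.
Import Order.TTheory GRing.Theory Num.Theory.
Import numFieldNormedType.Exports.

(** Let [z = x + iy] and [q t = e^(-zt) - 1 + zt]. The three equations
    [Delta s0 = Delta' s0 = Delta'' s0 = 0] determine [a0, a1, a2], and then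
    [Delta (s0 + z) = 0] reads [q tau1 / tau1^2 = q tau2 / tau2^2]. For
    [z <> 0] and [Re z >= 0] this is impossible because [t |-> |q t|^2 / t^4] is
    strictly decreasing on [t > 0]: up to a positive factor its derivative is
    [Re d - 2 |d|^2] with [d = 1/(1 - e^(-zt)) - 1/(zt)], and [Re d >= 1/2].

    For the stability part, a solution [y] is sampled at step [h]. The samples
    satisfy the explicit Euler recurrence [Q y = F], where
    [Q = (1 - X)/h + a0 X + a1 X^(J1+1) + a2 X^(J2+1)] in the shift [X], with a
    residual [F] of size [O(h)] times a local supremum of [|y|]. As [Delta] has
    no root in [Re s >= x0] for some [x0 < 0], [|Q|] is bounded below on the disc
    [|x| <= e^(-x0 h)], uniformly in small [h]. Parseval's identity on
    roots of unity then bounds the weighted [l^2] norm of the samples by that of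
    the residual; for [h] small the residual is absorbed, which leaves only the
    initial window. *)

Set Implicit Arguments.
Unset Strict Implicit.
Unset Printing Implicit Defensive.

Local Open Scope classical_set_scope.
Local Open Scope ring_scope.
Local Open Scope complex_scope.

(** * Real derivatives and elementary inequalities *)

Section Derivatives.
Context {R : realType}.
Implicit Types (f g : R -> R) (t a : R).

(* A wrapper around [is_derive] that type class resolution does not unfold and
   whose last argument lives in [R] itself, so that [ring] applies to it. *)
Definition has_der f t (d : R) := is_derive t 1 f d.

Lemma der_eq f t d d' : has_der f t d -> d = d' -> has_der f t d'.
Proof. by move=> ? <-. Qed.

Lemma der_cst t a : has_der (fun=> a) t 0.
Proof. exact: is_derive_cst. Qed.

Lemma der_id t : has_der (fun u => u) t 1.
Proof. exact: is_derive_id. Qed.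

Lemma der_add t f g df dg : has_der f t df -> has_der g t dg ->
  has_der (fun u => f u + g u) t (df + dg).
Proof. by move=> *; exact: is_deriveD. Qed.

Lemma der_opp t f df : has_der f t df -> has_der (fun u => - f u) t (- df).
Proof. by move=> *; exact: is_deriveN. Qed.

Lemma der_mul t f g df dg : has_der f t df -> has_der g t dg ->
  has_der (fun u => f u * g u) t (f t * dg + g t * df).
Proof. by move=> *; exact: is_deriveM. Qed.

Lemma der_comp t f g df dg : has_der f (g t) df -> has_der g t dg ->
  has_der (fun u => f (g u)) t (df * dg).
Proof. by move=> *; exact: is_derive1_comp. Qed.

Lemma der_exp t f df : has_der f t df ->
  has_der (fun u => expR (f u)) t (expR (f t) * df).
Proof. by apply: der_comp; exact: is_derive_expR. Qed.

Lemma der_cos t f df : has_der f t df ->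
  has_der (fun u => cos (f u)) t (- sin (f t) * df).
Proof. by apply: der_comp; exact: is_derive_cos. Qed.

Lemma der_sin t f df : has_der f t df ->
  has_der (fun u => sin (f u)) t (cos (f t) * df).
Proof. by apply: der_comp; exact: is_derive_sin. Qed.

Lemma der_continuous f df : (forall t, has_der f t (df t)) -> continuous f.
Proof.
move=> H t; apply/differentiable_continuous/derivable1_diffP.
exact: (@ex_derive _ _ _ _ _ _ _ (H t)).
Qed.

Lemma pos_of_derive f df x : (forall t, has_der f t (df t)) ->
  (forall t, 0 < t -> 0 < df t) -> f 0 = 0 -> 0 < x -> 0 < f x.
Proof.
move=> H dpos f0 x0.
have [|c cx] := MVT x0 (fun t _ => H t).
  by apply: continuous_subspaceT; exact: (der_continuous H).
rewrite f0 !subr0 => ->; rewrite mulr_gt0// dpos//.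
by move: cx; rewrite in_itv/= => /andP[].
Qed.

Lemma const_derive0 f a b k t d : (forall u, a < u < b -> f u = k) ->
  a < t < b -> has_der f t d -> d = 0.
Proof.
move=> fk tab fd.
suff: is_derive t 1 (fun=> k) d by move/@derive_val; rewrite derive_cst => <-.
apply: near_eq_is_derive fd => //.
have := near_in_itvoo (a := a) (b := b) (x := t).
rewrite in_itv/= => /(_ tab); apply: filterS => u; rewrite in_itv/=.
exact: fk.
Qed.

End Derivatives.

Ltac der_auto := repeat first [ apply: der_cst | apply: der_id | apply: der_exp
  | apply: der_cos | apply: der_sin | apply: der_opp | apply: der_mul
  | apply: der_add ].

Ltac der_compute := eapply der_eq; [der_auto | cbv beta].

(** * Elementary bounds for the exponential, the sine and the cosine *)

Section RealIneq.
Context {R : realType}.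
Implicit Types x y t X Y : R.

Lemma expR_mulN X : expR X * expR (- X) = 1.
Proof. exact: expRxMexpNx_1. Qed.

(** This is [X < sinh X] multiplied by [2 e^-X], so that only [e^-X] occurs. *)
Lemma sinh_gt X : 0 < X -> 2 * X * expR (- X) < 1 - expR (- X) ^+ 2.
Proof.
move=> X0.
have H : 0 < expR X + - expR (- X) + - (2 * X).
  apply: (@pos_of_derive _ (fun u => expR u + - expR (- u) + - (2 * u))
     (fun u => expR u + expR (- u) - 2)) X0 => [t|t t0|].
  - by der_compute; ring.
  - rewrite -(expR_mulN t).
    have e1 : 1 < expR t by rewrite expR_gt1.
    have e2 : expR (- t) < 1 by rewrite expR_lt1 oppr_lt0.
    have e0 := expR_mulN t.
    have : 0 < (expR t - 1) * (1 - expR (- t)) by rewrite mulr_gt0// subr_gt0.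
    nra.
  - by rewrite oppr0 mulr0 expR0; ring.
have E0 := expR_gt0 (- X).
have := mulr_gt0 H E0; have := expR_mulN X; nra.
Qed.

(** This is [tanh (X / 2) < X / 2], cleared of denominators. *)
Lemma tanh_half_lt X : 0 < X -> 2 * (1 - expR (- X)) < X * (1 + expR (- X)).
Proof.
move=> X0; rewrite -subr_gt0.
apply: (@pos_of_derive _ (fun u => u * (1 + expR (- u)) + - (2 * (1 + - expR (- u))))
     (fun u => 1 - expR (- u) * (1 + u))) X0 => [t|t t0|].
- by der_compute; ring.
- have h : 1 + t < expR t by apply: expR_gt1Dx; rewrite gt_eqF.
  have E0 := expR_gt0 (- t).
  have e0 := expR_mulN t; nra.
- by rewrite oppr0 expR0; ring.
Qed.

Lemma sin_le t : 0 <= t -> sin t <= t.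
Proof.
rewrite le_eqVlt => /predU1P[<-|t0]; first by rewrite sin0.
have [|c _] := MVT t0 (fun u _ => is_derive_sin u).
  by apply: continuous_subspaceT; exact: continuous_sin.
rewrite sin0 !subr0 => ->.
by rewrite ler_piMl ?cos_le1 ?ltW.
Qed.

Lemma abs_sin_le t : `|sin t| <= `|t|.
Proof.
wlog t0 : t / 0 <= t.
  move=> H; have [|t0] := leP 0 t; first exact: H.
  by rewrite -normrN -sinN -(normrN t); apply: H; rewrite oppr_ge0 ltW.
rewrite (ger0_norm t0) ler_norml sin_le// andbT.
have [t1|t1] := leP t 1.
  apply: (@le_trans _ _ 0); first by rewrite oppr_le0.
  apply: sin_ge0_pi; rewrite t0 (le_trans t1)//.
  by apply: le_trans (pi_ge2 _); rewrite ler1n.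
by apply: le_trans (sin_geN1 t); rewrite lerN2 ltW.
Qed.

Lemma sqr_sin_le t : sin t ^+ 2 <= t ^+ 2.
Proof. by rewrite -(real_normK (num_real (sin t))) -(real_normK (num_real t))
  lerXn2r ?nnegrE// abs_sin_le. Qed.

Lemma half2 t : t / 2 + t / 2 = t. Proof. by field. Qed.

Lemma cos_half t : cos t = 1 - 2 * sin (t / 2) ^+ 2.
Proof. by rewrite -{1}(half2 t) cosD -!expr2 cos2sin2; ring. Qed.

Lemma sin_half t : sin t = 2 * sin (t / 2) * cos (t / 2).
Proof. by rewrite -{1}(half2 t) sinD; ring. Qed.

Lemma cos_ge t : 2 * (1 - cos t) <= t ^+ 2.
Proof. by rewrite cos_half; have := sqr_sin_le (t / 2); nra. Qed.

End RealIneq.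

(** * Monotonicity along rays *)

Section Dominance.
Context {R : realType}.
Implicit Types x y t X Y : R.

Lemma der_inv (f : R -> R) t df : f t != 0 -> has_der f t df ->
  has_der (fun u => (f u)^-1) t (- df / f t ^+ 2).
Proof.
move=> ft0 fd; apply: der_eq; first exact: (is_deriveV ft0 fd).
by rewrite /GRing.scale/= mulrC mulNr mulrN.
Qed.

Let q2 (E c s X Y : R) := (E * c - 1 + X) ^+ 2 + (Y - E * s) ^+ 2.
Let qp (E c s X Y : R) := (E * c - 1 + X) * (X - E * (X * c + Y * s)) +
  (Y - E * s) * (Y + E * (X * s - Y * c)).

(* With [w = 1 - e^-z], [z = X + iY] and [q = z - w], the two quantities are
   [|q|^2] and [Re (q * conj (z w))]. For [d = q / (z w) = 1/w - 1/z] the claim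
   is [Re d < 2 |d|^2], which follows from [Re d > 1/2]. *)
Lemma qp_lt X Y : 0 < X ->
  qp (expR (- X)) (cos Y) (sin Y) X Y < 2 * q2 (expR (- X)) (cos Y) (sin Y) X Y.
Proof.
move=> X0.
have := sinh_gt X0; have := tanh_half_lt X0; have := cos_ge Y.
have : expR (- X) < 1 by rewrite expR_lt1 oppr_lt0.
have := cos_le1 Y; have := expR_gt0 (- X); have := cos2Dsin2 Y.
move: (expR (- X)) (cos Y) (sin Y) => E c s cs E0 c1 E1 cY th sh.
(* [M = |z w|^2]; as it is positive, [Re d > 1/2] takes the form [M < 2 qp]. *)
set M := (X ^+ 2 + Y ^+ 2) * (1 - 2 * E * c + E ^+ 2).
have M0 : 0 < M.
  apply: mulr_gt0; first by have := exprn_gt0 2 X0; have := sqr_ge0 Y; lra.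
  have := mulr_ge0 (ltW E0) (_ : 0 <= 1 - c); rewrite subr_ge0 => /(_ c1).
  have : 0 < (1 - E) ^+ 2 by rewrite exprn_gt0 ?subr_gt0.
  nra.
have TM : M < 2 * qp E c s X Y.
  have -> : qp E c s X Y = (X ^+ 2 + Y ^+ 2) * (1 - E * c)
      - X * (1 - 2 * E * c + E ^+ 2 * (c ^+ 2 + s ^+ 2)) by rewrite /qp; ring.
  rewrite cs mulr1 -subr_gt0.
  (* The gap splits into three terms, signed respectively by [tanh_half_lt], [sinh_gt] and
     [cos_ge]. *)
  have -> : 2 * ((X ^+ 2 + Y ^+ 2) * (1 - E * c)
      - X * (1 - 2 * E * c + E ^+ 2)) - M = X * ((1 - E) *
      (X * (1 + E) - 2 * (1 - E))) + Y ^+ 2 * (1 - E ^+ 2 - 2 * X * E)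
      + 2 * (X * E) * (Y ^+ 2 - 2 * (1 - c)) by rewrite /M; ring.
  have h1 : 0 < X * ((1 - E) * (X * (1 + E) - 2 * (1 - E))).
    by rewrite mulr_gt0// mulr_gt0// subr_gt0.
  have h2 : 0 <= Y ^+ 2 * (1 - E ^+ 2 - 2 * X * E).
    by rewrite mulr_ge0 ?sqr_ge0// subr_ge0 ltW.
  have h3 : 0 <= 2 * (X * E) * (Y ^+ 2 - 2 * (1 - c)).
    by rewrite mulr_ge0 ?subr_ge0// !mulr_ge0// ltW.
  lra.
(* Cauchy-Schwarz: [Re (q conj (z w))^2 <= |q|^2 |z w|^2]. Together with [TM] it gives
   [qp M < 2 qp^2 <= 2 q2 M]. *)
have QM : qp E c s X Y ^+ 2 <= q2 E c s X Y * M.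
  rewrite -subr_ge0.
  have -> : q2 E c s X Y * M - qp E c s X Y ^+ 2 =
     ((E * c - 1 + X) * (Y + E * (X * s - Y * c)) -
      (Y - E * s) * (X - E * (X * c + Y * s))) ^+ 2
      + q2 E c s X Y * (X ^+ 2 + Y ^+ 2) * E ^+ 2 * (1 - (c ^+ 2 + s ^+ 2)).
    by rewrite /qp /M /q2; ring.
  by rewrite cs subrr mulr0 addr0 sqr_ge0.
rewrite -(ltr_pM2r M0) -mulrA.
apply: lt_le_trans (ler_wpM2l (ler0n _ 2) QM).
have T0 : 0 < qp E c s X Y by rewrite -(pmulr_rgt0 _ (ltr0n _ 2)) (lt_trans M0).
by rewrite [ltRHS](_ : _ = qp E c s X Y * (2 * qp E c s X Y)) ?ltr_pM2l//; ring.
Qed.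

(** On the imaginary axis the inequality of [qp_lt] is only weak: in half angles the gap is a
    square, which vanishes when [tan (Y / 2) = Y / 2]. *)
Lemma qp_imaginary_axis Y : 2 * q2 (expR (- 0)) (cos Y) (sin Y) 0 Y -
    qp (expR (- 0)) (cos Y) (sin Y) 0 Y =
  2 * (2 * sin (Y / 2) - Y * cos (Y / 2)) ^+ 2.
Proof.
rewrite oppr0 expR0 (cos_half Y) (sin_half Y) /q2 /qp.
have := cos2Dsin2 (Y / 2); move: (cos _) (sin _) => c s cs.
apply/eqP; rewrite -subr_eq0; apply/eqP.
transitivity ((8 * s ^+ 2 - 2 * Y ^+ 2) * (c ^+ 2 + s ^+ 2 - 1)); first by ring.
by rewrite cs subrr mulr0.
Qed.

(* [ratio x y t = |e^-zt - 1 + zt|^2 / t^4] for [z = x + iy]. *)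
Definition ratio x y t := ((expR (- (x * t)) * cos (y * t) - 1 + x * t) ^+ 2 +
  (y * t - expR (- (x * t)) * sin (y * t)) ^+ 2) / t ^+ 4.

Let dratio x y t := - 2 / t ^+ 5 *
  (2 * q2 (expR (- (x * t))) (cos (y * t)) (sin (y * t)) (x * t) (y * t) -
   qp (expR (- (x * t))) (cos (y * t)) (sin (y * t)) (x * t) (y * t)).

Lemma der_ratio x y t : 0 < t -> has_der (ratio x y) t (dratio x y t).
Proof.
move=> t0; have tn0 : t != 0 by rewrite gt_eqF.
have -> : ratio x y = fun u => ((expR (- (x * u)) * cos (y * u) + - 1 + x * u) *
  (expR (- (x * u)) * cos (y * u) + - 1 + x * u) +
  (y * u + - (expR (- (x * u)) * sin (y * u))) *
  (y * u + - (expR (- (x * u)) * sin (y * u)))) * (u * u * u * u)^-1.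
  by apply/funext => u; rewrite /ratio; congr (_ * _^-1); ring.
apply: der_eq.
  by apply: der_mul; [der_auto|apply: der_inv; [rewrite !mulf_neq0|der_auto]].
rewrite /dratio /q2 /qp; field.
by [].
Qed.

(** The derivative of [ratio] is negative for [x > 0], but only nonpositive for [x = 0]. Weak
    monotonicity comes first; equality at [t1] and [t2] would make [ratio] constant between them, so
    that its derivative would vanish on a whole interval. *)
Lemma ratio_lt x y t1 t2 : 0 <= x -> (x, y) != (0, 0) -> 0 < t1 -> t1 < t2 ->
  ratio x y t2 < ratio x y t1.
Proof.
move=> x0 xy0 t1_gt0 t12.
have pos t : t1 <= t -> 0 < t by exact: lt_le_trans.
have mono a b : t1 <= a -> a < b -> exists2 c, a < c < b &
    ratio x y b - ratio x y a = dratio x y c * (b - a).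
  move=> ta ab.
  have der c : c \in `[a, b]%R -> has_der (ratio x y) c (dratio x y c).
    by rewrite in_itv/= => /andP[ac _]; apply/der_ratio/pos/(le_trans ta).
  have cont : {within `[a, b], continuous (ratio x y)}.
    apply: derivable_within_continuous => c /der.
    exact: (@ex_derive _ _ _ _ _ _ _).
  have [c cab e] := @MVT _ (ratio x y) (dratio x y) a b ab
    (fun c cab => der c (subset_itv_oo_cc cab)) cont.
  by exists c => //; rewrite in_itv in cab.
have L0 X Y : 0 <= X -> qp (expR (- X)) (cos Y) (sin Y) X Y <=
    2 * q2 (expR (- X)) (cos Y) (sin Y) X Y.
  rewrite le_eqVlt => /predU1P[<-|X0]; last exact/ltW/qp_lt.
  by rewrite -subr_ge0 qp_imaginary_axis mulr_ge0 ?sqr_ge0.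
have d0 c : t1 < c -> dratio x y c <= 0.
  move=> tc; have c0 := pos _ (ltW tc).
  rewrite /dratio mulNr mulNr oppr_le0 mulr_ge0//.
    by rewrite divr_ge0// exprn_ge0// ltW.
  by rewrite subr_ge0 L0// mulr_ge0// ltW.
have le a b : t1 <= a -> a <= b -> ratio x y b <= ratio x y a.
  rewrite [a <= b]le_eqVlt => ta /predU1P[->//|ab].
  have [c /andP[ac cb] e] := mono a b ta ab.
  rewrite -subr_le0 e mulr_le0_ge0 ?subr_ge0 ?(ltW ab)//.
  by rewrite d0// (le_lt_trans ta).
rewrite lt_neqAle le ?(ltW t12)// andbT; apply/eqP => e12.
have cst u : t1 < u < t2 -> ratio x y u = ratio x y t1.
  move=> /andP[tu ut]; apply/eqP; rewrite eq_le le ?(ltW tu)//=.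
  by rewrite -e12 le// ltW.
have dz u : t1 < u < t2 -> 2 * q2 (expR (- (x * u))) (cos (y * u)) (sin (y * u)) (x
  * u) (y * u) -
   qp (expR (- (x * u))) (cos (y * u)) (sin (y * u)) (x * u) (y * u) = 0.
  move=> u12; have u0 : 0 < u by case/andP: u12 => /ltW /pos.
  have /eqP : dratio x y u = 0 by exact: const_derive0 cst u12 (der_ratio _ _ u0).
  by rewrite mulf_eq0 mulf_eq0 oppr_eq0 pnatr_eq0 invr_eq0 expf_eq0/= gt_eqF//= => /eqP.
have m12 : t1 < (t1 + t2) / 2 < t2 by rewrite midf_lt// andbC midf_lt.
have [x_gt0|x_le0] := ltP 0 x.
  have /eqP := dz _ m12; rewrite subr_eq0 gt_eqF// qp_lt// mulr_gt0//.
  by case/andP: m12 => /ltW/pos.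
have {x0 x_le0}x0 : x = 0 by apply/eqP; rewrite eq_le x_le0.
subst x; have y0 : y != 0 by apply: contraNneq xy0 => ->.
(* The base of the square in [qp_imaginary_axis]. It vanishes on the interval and has derivative
   [y^2 u sin (y u / 2) / 2], so the sine vanishes there; then [g = 0] makes the cosine vanish
   too. *)
pose g u := 2 * sin (y * u / 2) + - (y * u * cos (y * u / 2)).
have gz u : t1 < u < t2 -> g u = 0.
  move=> /dz; rewrite !mul0r qp_imaginary_axis => /eqP.
  by rewrite mulf_eq0 pnatr_eq0/= sqrf_eq0 => /eqP.
have sz u : t1 < u < t2 -> sin (y * u / 2) = 0.
  move=> u12; have u0 : 0 < u by case/andP: u12 => /ltW /pos.
  have : has_der g u (y ^+ 2 * u / 2 * sin (y * u / 2)) by rewrite /g; der_compute;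
    field.
  move/(const_derive0 gz u12)/eqP.
  by rewrite !mulf_eq0 invr_eq0 pnatr_eq0 (negbTE y0) (gt_eqF u0)/= => /eqP.
have := gz _ m12; rewrite /g sz// mulr0 add0r => /eqP.
have m0 : 0 < (t1 + t2) / 2 by case/andP: m12 => /ltW/pos.
rewrite oppr_eq0 mulf_eq0 mulf_eq0 (negbTE y0) (gt_eqF m0)/= => /eqP e.
by have /eqP := cos2Dsin2 (y * ((t1 + t2) / 2) / 2);
  rewrite sz// e !expr0n addr0 eq_sym oner_eq0.
Qed.

End Dominance.

(** * The complex exponential *)

Import Normc.

(* Stated over an abstract [K] because the concrete type [R[i]] has no canonical
   structure of normed module over itself. *)
Definition has_kder (K : numFieldType) (f : K -> K) (z d : K) :=
  is_derive z 1 f d.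

Section KDerive.
Variable K : numFieldType.
Implicit Types (f g : K -> K) (z d : K).

Lemma kderP f z d : (forall e, 0 < e -> exists2 r, 0 < r & forall h, h != 0 ->
    `|h| < r -> `|d - h^-1 * (f (h + z) - f z)| <= e) -> has_kder f z d.
Proof.
move=> H.
suff L : (fun h : K => h^-1 *: ((f \o shift z) (h *: 1) - f z)) @ 0^' --> d.
  by apply: DeriveDef; [exact: cvgP L|exact: (cvg_lim _ L)].
apply/cvgrPdist_le => /= e /H[r r0 er].
exists r => // h /=; rewrite sub0r normrN => hr h0.
rewrite /GRing.scale/= mulr1; exact: er.
Qed.

Lemma kder_add f g z df dg : has_kder f z df -> has_kder g z dg ->
  has_kder (fun s => f s + g s) z (df + dg).
Proof. by move=> ? ?; exact: is_deriveD. Qed.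

Lemma kder_cst z a : has_kder (fun=> a) z 0.
Proof. exact: is_derive_cst. Qed.

Lemma kder_id z : has_kder (fun s => s) z 1.
Proof. exact: is_derive_id. Qed.

Lemma kder_mulc f z df a : has_kder f z df -> has_kder (fun s => a * f s) z (a * df).
Proof. by move=> ?; exact: is_deriveZ. Qed.

(** Unfolds the iterated derivatives one explicit derivative at a time. *)
Lemma root_multiplicity_derivative f f' z m : root_multiplicity f z m.+1 ->
  (forall s, has_kder f s (f' s)) -> f z = 0 /\ root_multiplicity f' z m.
Proof.
move=> [H Hn] fd.
have fE : derive1 f = f'.
  by apply/funext => s; rewrite derive1E (@derive_val _ _ _ _ _ _ _ (fd s)).
split; first by have := H 0 isT; rewrite derive1n0.
by split=> [k km|]; [have := H k.+1 km|move: Hn]; rewrite derive1Sn fE.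
Qed.

End KDerive.

Section ComplexExp.
Context {R : realType}.
Implicit Types (z w : R[i]) (a b t : R).

Lemma normcE2 z : normc z ^+ 2 = complex.Re z ^+ 2 + complex.Im z ^+ 2.
Proof. by case: z => a b /=; rewrite sqr_sqrtr// addr_ge0 ?sqr_ge0. Qed.

Lemma normr_normc z : `|z| = (normc z)%:C. Proof. by []. Qed.

Lemma normc_ge0 z : 0 <= normc z.
Proof. by case: z => a b /=; exact: sqrtr_ge0. Qed.

Lemma normc_le_add z : normc z <= `|complex.Re z| + `|complex.Im z|.
Proof.
rewrite -ler_sqr ?nnegrE ?normc_ge0 ?addr_ge0// normcE2 sqrrD !real_normK ?num_real//.
by rewrite -addrA lerD2l lerDr mulrn_wge0// mulr_ge0.
Qed.

Lemma abs_Re_le z : `|complex.Re z| <= normc z.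
Proof.
rewrite -ler_sqr ?nnegrE ?normc_ge0// normcE2 real_normK ?num_real//.
by rewrite lerDl sqr_ge0.
Qed.

Lemma abs_Im_le z : `|complex.Im z| <= normc z.
Proof.
rewrite -ler_sqr ?nnegrE ?normc_ge0// normcE2 real_normK ?num_real//.
by rewrite lerDr sqr_ge0.
Qed.

Lemma normcR a : normc a%:C = `|a|.
Proof. by rewrite /= expr0n/= addr0 sqrtr_sqr. Qed.

Lemma cexpD z w : cexp (z + w) = cexp z * cexp w.
Proof.
case: z w => [a b] [c d]; rewrite /cexp/= expRD cosD sinD.
by apply/eqP; rewrite eq_complex/=; apply/andP; split; apply/eqP; ring.
Qed.

Lemma normcX z n : normc (z ^+ n) = normc z ^+ n.
Proof. by elim: n => [|n IH]; rewrite ?normc1// !exprS normcM IH. Qed.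

Lemma normc_geB z w : normc z - normc w <= normc (z + w).
Proof.
rewrite lerBlDr -[leLHS]/(normc z) -{1}[z](addrK w).
by apply: le_trans (le_normcD _ _) _; rewrite normcN.
Qed.

Lemma cexp0 : cexp (0 : R[i]) = 1.
Proof. by rewrite /cexp/= expR0 cos0 sin0 mul1r. Qed.

Lemma cexpMn z n : cexp (z *+ n) = cexp z ^+ n.
Proof. by elim: n => [|n IH]; rewrite ?cexp0// mulrS exprS cexpD IH. Qed.

Lemma cexp_real a : cexp a%:C = (expR a)%:C.
Proof. by rewrite /cexp/= cos0 sin0 mulr1. Qed.

Lemma normc_cexp z : normc (cexp z) = expR (complex.Re z).
Proof.
rewrite /cexp normcM normcR ger0_norm ?expR_ge0//.
by rewrite /normc cos2Dsin2 sqrtr1 mulr1.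
Qed.

(** Everything comes from [1 + a <= e^a] and from the same inequality at [-a], in the form
    [e^a (1 - a) <= 1]. *)
Lemma expR_sub1_bound a : `|a| <= 2^-1 ->
  [/\ expR a <= 2, 0 <= expR a - 1 - a <= 2 * a ^+ 2 & `|expR a - 1| <= 2 * `|a|].
Proof.
move=> ha; have {}ha' : - 2^-1 <= a <= 2^-1 by rewrite -ler_norml.
case/andP: ha' => h1 h2.
have e1 := expR_ge1Dx a.
have e2 := expR_ge1Dx (- a).
have e3 := expRxMexpNx_1 a.
have e4 := expR_gt0 a.
have u : expR a * (1 - a) <= 1 by rewrite -[leRHS]e3 ler_wpM2l// ltW.
have v : expR a <= 1 + a + 2 * a ^+ 2.
  rewrite -(@ler_pM2r _ (1 - a)); last by lra.
  apply: le_trans u _; have : 0 <= a ^+ 2 * (1 - 2 * a).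
    by rewrite mulr_ge0 ?sqr_ge0//; lra.
  have -> : (1 + a + 2 * a ^+ 2) * (1 - a) = 1 + a ^+ 2 * (1 - 2 * a) by ring.
  by rewrite lerDl.
have a2 : a ^+ 2 <= 2^-1 * `|a|.
  by rewrite -(real_normK (num_real a)) expr2 ler_wpM2r.
split; [nra|lra|].
have := ler_norm a; have := ler_norm (- a); rewrite normrN ler_norml => ? ?.
have : 0 <= expR a - 1 - a by lra.
by move=> ?; lra.
Qed.

Lemma sin_sub_bound b : `|b| <= 2^-1 -> `|sin b - b| <= b ^+ 2 / 2.
Proof.
wlog b0 : b / 0 <= b.
  move=> H; have [|b0] := leP 0 b; first exact: H.
  move=> hb; have := H (- b); rewrite oppr_ge0 (ltW b0) normrN => /(_ isT hb).
  by rewrite sinN -opprD normrN sqrrN.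
rewrite (ger0_norm b0) => b1.
rewrite ler0_norm ?subr_le0 ?sin_le//.
move: b0; rewrite le_eqVlt => /predU1P[<-|b0]; first by rewrite sin0; lra.
have [|c] := MVT b0 (fun u _ => is_derive_sin u).
  by apply: continuous_subspaceT; exact: continuous_sin.
rewrite sin0 !subr0 in_itv/= => /andP[c0 cb] ->.
have := cos_ge c; have : c ^+ 2 <= b ^+ 2 by rewrite lerXn2r ?nnegrE// ltW.
have : b ^+ 2 <= b by rewrite expr2 ler_piMl ?ltW//; lra.
nra.
Qed.

(** For [z = a + ib], the real and imaginary parts of the remainder are split into second-order
    pieces. They are bounded by [2a^2 + b^2] and [a^2 + 2b^2], which add up to [3|z|^2]. *)
Lemma cexp_bound z : normc z <= 2^-1 ->
  normc (cexp z - 1 - z) <= 3 * normc z ^+ 2.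
Proof.
move=> hz.
have ha := le_trans (abs_Re_le z) hz; have hb := le_trans (abs_Im_le z) hz.
rewrite normcE2; apply: le_trans (normc_le_add _) _.
case: z {hz} ha hb => a b /= ha hb.
have [e2 /andP[e3 e4] e5] := expR_sub1_bound ha.
have s1 := sin_sub_bound hb; have c1 := cos_ge b; have c2 := cos_le1 b.
have e0 := expR_gt0 a.
rewrite !mul0r subr0 !addr0 !subr0.
have -> : expR a * cos b - 1 - a = (expR a - 1 - a) - expR a * (1 - cos b) by ring.
have -> : expR a * sin b - b = expR a * (sin b - b) + (expR a - 1) * b by ring.
apply: (@le_trans _ _ ((2 * a ^+ 2 + b ^+ 2) + (b ^+ 2 + (a ^+ 2 + b ^+ 2)))).
  apply: lerD.
    apply: le_trans (ler_normB _ _) _; apply: lerD.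
      by rewrite ger0_norm.
    rewrite ger0_norm ?mulr_ge0 ?subr_ge0 ?(ltW e0)//.
    by apply: le_trans (ler_wpM2r _ e2) _ => //; rewrite subr_ge0.
  apply: le_trans (ler_normD _ _) _; rewrite !normrM; apply: lerD.
    rewrite (ger0_norm (ltW e0)); have := ler_pM (ltW e0) (normr_ge0 _) e2 s1; lra.
  apply: le_trans (ler_wpM2r _ e5) _ => //.
  rewrite -(real_normK (num_real a)) -(real_normK (num_real b)).
  by have := sqr_ge0 (`|a| - `|b|); lra.
by have := sqr_ge0 a; have := sqr_ge0 b; lra.
Qed.

Lemma cexp_bound1 z : normc z <= 2^-1 -> normc (cexp z - 1) <= 3 * normc z.
Proof.
move=> hz; have -> : cexp z - 1 = (cexp z - 1 - z) + z by ring.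
apply: le_trans (le_normcD _ _) _; have := cexp_bound hz.
have : normc z ^+ 2 <= 2^-1 * normc z by rewrite expr2 ler_wpM2r// normc_ge0.
by have := normc_ge0 z; lra.
Qed.

(** By [cexp_bound] at [-h t], the difference quotient has an error of at most [K |h|]; the radius
    [1 / (2 (|t| + 1))] keeps [|h t|] below [1/2]. *)
Lemma kder_cexpM (t : R) z :
  has_kder (fun s : R[i] => cexp (- s * t%:C)) z
    (- t%:C * cexp (- z * t%:C)).
Proof.
pose K := 3 * t ^+ 2 * normc (cexp (- z * t%:C)).
have K0 : 0 <= K by apply: mulr_ge0; [apply: mulr_ge0;
  [|exact: sqr_ge0]|exact: normc_ge0].
have E0 h : h != 0 -> normc h <= (2 * (`|t| + 1))^-1 ->
   normc (- t%:C * cexp (- z * t%:C) -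
   h^-1 * (cexp (- (h + z) * t%:C) - cexp (- z * t%:C))) <= K * normc h.
  move=> h0 hh.
  have -> : - t%:C * cexp (- z * t%:C) -
    h^-1 * (cexp (- (h + z) * t%:C) - cexp (- z * t%:C)) =
    - (h^-1 * cexp (- z * t%:C) * (cexp (- h * t%:C) - 1 - (- h * t%:C))).
    have -> : - (h + z) * t%:C = - h * t%:C + - z * t%:C.
      ring.
    rewrite cexpD; move: (cexp _) (cexp _) => A B.
    by field.
  rewrite normcN (normcM (h^-1 * _)) (normcM h^-1) normcV.
  have hn0 : 0 < normc h.
    by rewrite lt_neqAle normc_ge0 andbT eq_sym; apply: contra h0 => /eqP/eq0_normc->.
  have := @cexp_bound (- h * t%:C); rewrite normcM normcN normcR => H.
  have /H {}H : normc h * `|t| <= 2^-1.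
    have t0 : 0 < `|t| + 1 by rewrite ltr_wpDl.
    apply: le_trans (ler_wpM2r (normr_ge0 t) hh) _.
    rewrite invfM -mulrA ler_piMr ?invr_ge0// mulrC ler_pdivrMr// mul1r.
    by rewrite lerDl.
  apply: (@le_trans _ _ ((normc h)^-1 * normc (cexp (- z * t%:C)) * (3 * (normc h *
    `|t|) ^+ 2))).
    by rewrite ler_wpM2l// mulr_ge0 ?invr_ge0 ?normc_ge0.
  rewrite le_eqVlt; apply/orP; left; apply/eqP.
  rewrite /K -(real_normK (num_real t)); field; exact: lt0r_neq0.
apply: kderP => e e0.
have [r r0 er] : exists2 r : R, 0 < r & e = r%:C.
  move: e0; case: e => a b; rewrite ltcE/= => /andP[/eqP -> a0].
  by exists a.
pose d := Num.min (2 * (`|t| + 1))^-1 (r / (K + 1)).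
have d0 : 0 < d.
  rewrite lt_min invr_gt0 mulr_gt0 ?ltr_wpDl//= divr_gt0// ltr_wpDl//.
exists d%:C; first by rewrite /= ltcR.
move=> h h0; rewrite normr_normc ltcR => hd.
rewrite er normr_normc lecR.
have := hd; rewrite lt_min => /andP[hd1 hd2].
apply: le_trans (E0 _ h0 (ltW hd1)) _.
apply: le_trans (ler_wpM2l K0 (ltW hd2)) _.
rewrite mulrCA ler_piMr ?(ltW r0)// ler_pdivrMr ?ltr_wpDl// mul1r lerDl//.
Qed.

End ComplexExp.

(** * Triple roots are dominant *)

Section TripleRoot.
Context {R : realType}.

(** A family that contains [charfun] and is closed under differentiation. *)
Let quasipoly (tau1 tau2 : R) (c0 c1 b1 b2 : R[i]) (s : R[i]) : R[i] :=
  c0 * s + c1 + b1 * cexp (- s * tau1%:C) + b2 * cexp (- s * tau2%:C).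

Lemma kder_quasipoly (tau1 tau2 : R) c0 c1 b1 b2 z :
  has_kder (quasipoly tau1 tau2 c0 c1 b1 b2) z
    (quasipoly tau1 tau2 0 c0 (- tau1%:C * b1) (- tau2%:C * b2) z).
Proof.
rewrite /quasipoly.
have -> : 0 * z + c0 + - tau1%:C * b1 * cexp (- z * tau1%:C) +
    - tau2%:C * b2 * cexp (- z * tau2%:C) =
  c0 * 1 + 0 + b1 * (- tau1%:C * cexp (- z * tau1%:C)) +
    b2 * (- tau2%:C * cexp (- z * tau2%:C)) by ring.
apply: kder_add; last by apply: kder_mulc; exact: kder_cexpM.
apply: kder_add; last by apply: kder_mulc; exact: kder_cexpM.
by apply: kder_add; [apply: kder_mulc; exact: kder_id|exact: kder_cst].
Qed.

(** Absorbing the exponentials at [s0] into [b1] and [b2] turns the vanishing of [Delta], [Delta']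
    and [Delta''] into a real linear system. *)
Lemma root_multiplicity3 (a0 a1 a2 tau1 tau2 s0 : R) :
  root_multiplicity (charfun a0 a1 a2 tau1 tau2) s0%:C 3%N ->
  let b1 := a1 * expR (- s0 * tau1) in let b2 := a2 * expR (- s0 * tau2) in
  [/\ s0 + a0 + b1 + b2 = 0, tau1 * b1 + tau2 * b2 = 1 &
      tau1 ^+ 2 * b1 + tau2 ^+ 2 * b2 = 0].
Proof.
move=> + b1 b2.
have fE : charfun a0 a1 a2 tau1 tau2 = quasipoly tau1 tau2 1 a0%:C a1%:C a2%:C.
  by apply/funext => s; rewrite /charfun /quasipoly mul1r.
have e tau : cexp (- s0%:C * tau%:C) = (expR (- s0 * tau))%:C.
  by rewrite -rmorphN -rmorphM/= cexp_real.
rewrite fE => /root_multiplicity_derivative/(_ (kder_quasipoly _ _ _ _ _ _)).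
move=> [h0 /root_multiplicity_derivative/(_ (kder_quasipoly _ _ _ _ _ _))].
move=> [h1 /root_multiplicity_derivative/(_ (kder_quasipoly _ _ _ _ _ _)) [+ _]].
move: h0 h1; rewrite /quasipoly !e.
rewrite !mul0r !add0r mul1r -?(rmorphN, rmorphM, rmorphD, rmorph1)/=.
move=> /(congr1 (@complex.Re R))/= h0 /(congr1 (@complex.Re R))/= h1.
move=> /(congr1 (@complex.Re R))/= h2; rewrite /b1 /b2.
split.
- by rewrite -[RHS]h0; ring.
- by apply/eqP; rewrite -subr_eq0 -oppr_eq0 -[X in _ == X]h1; apply/eqP; ring.
- by rewrite -[RHS]h2; ring.
Qed.

(** Another root [s0 + z] with [Re z >= 0] would give [ratio] equal values at [tau1] and [tau2],
    contrary to [ratio_lt]. *)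
Lemma triple_root_dominant (a0 a1 a2 tau1 tau2 s0 : R) : 0 < tau1 -> tau1 < tau2 ->
  root_multiplicity (charfun a0 a1 a2 tau1 tau2) s0%:C 3%N ->
  strictly_dominant (charfun a0 a1 a2 tau1 tau2) s0.
Proof.
move=> t1 t12 H; split; first by have [/(_ 0%N isT)] := H.
have [h0 h1 h2] := root_multiplicity3 H.
case=> sigma om; rewrite /charfun /cexp /= => /eqP; rewrite eq_complex/=.
rewrite !mul0r !mulr0 !addr0 !subr0 ?add0r.
move=> /andP[/eqP hre /eqP him].
have [|sgt] := ltP sigma s0; first by right.
left; apply/eqP; rewrite eq_complex/=; apply: contraT => ne.
have := @ratio_lt R (sigma - s0) om tau1 tau2.
rewrite subr_ge0 sgt => /(_ isT) A; exfalso.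
have {A}/A : (sigma - s0, om) != (0, 0).
  by rewrite xpair_eqE subr_eq0.
move=> /(_ t1 t12); rewrite lt_neqAle => /andP[+ _]; apply/negP; rewrite negbK.
have t2 := lt_trans t1 t12.
have [n1 n2 n12] : [/\ tau1 != 0, tau2 != 0 & tau2 - tau1 != 0].
  by rewrite !gt_eqF// subr_gt0.
set B1 := a1 * _ in h0 h1 h2; set B2 := a2 * expR (- s0 * tau2) in h0 h1 h2.
have split_exp tau : expR (- sigma * tau) =
    expR (- s0 * tau) * expR (- ((sigma - s0) * tau)).
  by rewrite -expRD; congr expR; ring.
move: hre him; rewrite /ratio !split_exp !(mulNr om) !cosN !sinN !mulrA -/B1 -/B2.
move: (expR (- ((sigma - s0) * tau1))) (expR (- ((sigma - s0) * tau2)))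
  (cos (om * tau1)) (cos (om * tau2)) (sin (om * tau1)) (sin (om * tau2))
  => E1 E2 c1 c2 s1 s2 hre him.
(* Cramer's rule for the last two equations of [root_multiplicity3]. *)
have B2E : B2 = - tau1 / (tau2 * (tau2 - tau1)).
  apply: (mulfI (mulf_neq0 n2 n12)); rewrite [RHS]mulrC divfK ?mulf_neq0//.
  by rewrite -[in RHS](mulr1 tau1) -mulNr -h1 -[LHS]subr0 -h2; ring.
have B1E : B1 = tau2 / (tau1 * (tau2 - tau1)).
  apply: (mulfI (mulf_neq0 n1 n12)); rewrite [RHS]mulrC divfK ?mulf_neq0//.
  by rewrite -[in RHS](mulr1 tau2) -h1 -[LHS]addr0 -h2; ring.
(* Subtracting [Delta s0 = 0] eliminates [a0]. After multiplication by [tau1 tau2 (tau2 - tau1)],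
   the real part of [Delta (s0 + z) = 0] becomes that of [tau1^2 q tau2 = tau2^2 q tau1]; [him] is
   the imaginary part. *)
have {}hre : tau1 ^+ 2 * (E2 * c2 - 1 + (sigma - s0) * tau2) =
    tau2 ^+ 2 * (E1 * c1 - 1 + (sigma - s0) * tau1).
  have : sigma - s0 + B1 * (E1 * c1 - 1) + B2 * (E2 * c2 - 1) = 0.
    by rewrite -(subrr 0) -{1}hre -h0; ring.
  rewrite B1E B2E => /(congr1 (fun u => tau1 * tau2 * (tau2 - tau1) * u)).
  rewrite mulr0 => e; apply/eqP; rewrite eq_sym -subr_eq0 -[X in _ == X]e; apply/eqP.
  by field; rewrite n12 n2 n1.
have {}him : tau1 ^+ 2 * (om * tau2 - E2 * s2) = tau2 ^+ 2 * (om * tau1 - E1 * s1).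
  move: him; rewrite B1E B2E => /(congr1 (fun u => tau1 * tau2 * (tau2 - tau1) * u)).
  rewrite mulr0 => e; apply/eqP; rewrite eq_sym -subr_eq0 -[X in _ == X]e; apply/eqP.
  by field; rewrite n12 n2 n1.
rewrite eqr_div ?expf_neq0//; apply/eqP.
have sq (a b : R) : (a ^+ 2 + b ^+ 2) * tau1 ^+ 4 =
    (tau1 ^+ 2 * a) ^+ 2 + (tau1 ^+ 2 * b) ^+ 2 by ring.
by rewrite sq hre him; ring.
Qed.

End TripleRoot.

(** * Parseval identity and division of sequences *)

Section Parseval.
Variable C : numClosedFieldType.
Implicit Types (z r : C) (P : {poly C}).

(** [X^n - 1] is separable, hence has [n] distinct roots, and they form a cyclic group. *)
Lemma prim_root_exists n : (0 < n)%N -> exists z : C, n.-primitive_root z.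
Proof.
move=> n0; have [rs rsE] := closed_field_poly_normal ('X^n - 1 : {poly C}).
move: rsE; rewrite (monicP _) ?monicXnsubC// scale1r => rsE.
have un : uniq rs.
  by rewrite -separable_prod_XsubC -rsE separable_Xn_sub_1// pnatr_eq0 -lt0n.
have unity : all n.-unity_root rs.
  by apply/allP => z; rewrite -root_prod_XsubC -rsE.
have sz : (n <= size rs)%N.
  by rewrite -ltnS -(size_prod_XsubC rs id) -rsE size_XnsubC.
by have /hasP[z _ zP] := cyclic.has_prim_root n0 unity un sz; exists z.
Qed.

Lemma norm_prim_root n z : n.-primitive_root z -> `|z| = 1.
Proof.
move=> zP; have n0 := prim_order_gt0 zP.
have : `|z| ^+ n == 1 by rewrite -normrX prim_expr_order// normr1.
by rewrite pexpr_eq1// => /eqP.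
Qed.

(** A geometric sum whose ratio [q] satisfies [q^n = 1]: unless [q = 1], it vanishes. *)
Lemma prim_root_orthogonal n z (i j : 'I_n) : n.-primitive_root z ->
  \sum_(k < n) (z ^+ k) ^+ i * ((z ^+ k) ^+ j)^* = (i == j)%:R * n%:R.
Proof.
move=> zP; have nz m : `|z ^+ m| = 1 by rewrite normrX (norm_prim_root zP) expr1n.
pose q := z ^+ i * (z ^+ j)^*.
have -> : \sum_(k < n) (z ^+ k) ^+ i * ((z ^+ k) ^+ j)^* = \sum_(k < n) q ^+ k.
  by apply: eq_bigr => k _; rewrite /q exprMn -rmorphXn/= -!exprM [(k * i)%N]mulnC
    [(k * j)%N]mulnC.
have [ij|ij] := eqVneq i j.
  have -> : q = 1 by rewrite /q ij -normCK nz expr1n.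
  by rewrite mul1r (eq_bigr (fun=> 1)) => [|k _]; rewrite ?expr1n// sumr_const card_ord.
have q1 : q - 1 != 0.
  rewrite subr_eq0; apply: contra ij => /eqP q1.
  have : z ^+ i == z ^+ j.
    have -> : z ^+ i = z ^+ i * (z ^+ j * (z ^+ j)^*) by rewrite -normCK nz expr1n
      mulr1.
    by rewrite mulrCA -/q q1 mulr1.
  by rewrite (eq_prim_root_expr zP) !modn_small.
rewrite mul0r; apply: (mulfI q1); rewrite -subrX1 mulr0 /q exprMn -rmorphXn/= -!exprM.
rewrite [(i * n)%N]mulnC [(j * n)%N]mulnC !exprM (prim_expr_order zP) !expr1n.
by rewrite rmorph1 mulr1 subrr.
Qed.

(** Expand [|P|^2 = P conj P] and sum over the sample points first: all indices being below [n],
    orthogonality leaves only the diagonal terms. *)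
Lemma parseval n z r P : n.-primitive_root z -> (size P <= n)%N ->
  \sum_(k < n) `|P.[r * z ^+ k]| ^+ 2 = n%:R * \sum_(j < n) `|P`_j * r ^+ j| ^+ 2.
Proof.
move=> zP szP; pose c j := P`_j * r ^+ j.
have PE (k : 'I_n) : P.[r * z ^+ k] = \sum_(i < n) c i * (z ^+ k) ^+ i.
  rewrite (horner_coef_wide _ szP); apply: eq_bigr => i _.
  by rewrite exprMn mulrA.
transitivity (\sum_(i < n) \sum_(j < n) c i * (c j)^* *
    \sum_(k < n) (z ^+ k) ^+ i * ((z ^+ k) ^+ j)^*).
  under eq_bigr => k _ do rewrite normCK PE rmorph_sum big_distrlr/=.
  rewrite exchange_big; apply: eq_bigr => i _; rewrite exchange_big/=.
  apply: eq_bigr => j _; rewrite mulr_sumr; apply: eq_bigr => k _.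
  by rewrite rmorphM/= mulrACA.
rewrite mulr_sumr; apply: eq_bigr => i _.
rewrite (bigD1 i)//= prim_root_orthogonal// eqxx mul1r big1 => [|j ji].
  by rewrite addr0 -normCK mulrC.
by rewrite prim_root_orthogonal// eq_sym (negbTE ji) mul0r mulr0.
Qed.

(** By Parseval both sides are, up to the factor [n], sums over the same points of the circle
    [|x| = |r|], where [|Q P| >= c |P|] pointwise. *)
Lemma poly_mul_lower (c r : C) (P Q : {poly C}) n : (size P <= n)%N -> (size (Q *
  P)%R <= n)%N ->
  0 <= c -> (forall x, `|x| = `|r| -> c <= `|Q.[x]|) ->
  c ^+ 2 * \sum_(j < n) `|P`_j * r ^+ j| ^+ 2 <=
  \sum_(j < n) `|(Q * P)`_j * r ^+ j| ^+ 2.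
Proof.
case: n => [|n]; first by rewrite !big_ord0 mulr0.
move=> szP szQP c0 cQ; have [z zP] := prim_root_exists (ltn0Sn n).
rewrite -(ler_pM2l (ltr0Sn C n)) -(parseval r zP szQP) mulrCA -(parseval r zP szP).
rewrite mulr_sumr; apply: ler_sum => k _.
rewrite hornerM normrM exprMn ler_wpM2r ?exprn_ge0//.
rewrite lerXn2r ?nnegrE// cQ// normrM normrX (norm_prim_root zP) expr1n mulr1//.
Qed.

End Parseval.

(** * Division of sequences by a polynomial without roots in a disc *)

Section PowerSeriesDivision.
Context {R : realType}.
Local Notation C := R[i].
Implicit Types (Q : {poly C}) (V g y : nat -> C) (r s c : R).

(* Coefficients of the product of [Q] with the power series of coefficients [V]. *)
Definition conv Q V (j : nat) : C := \sum_(i < j.+1) Q`_i * V (j - i)%N.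

Lemma conv_poly Q V m j : (j < m)%N -> conv Q V j = (Q * \poly_(i < m) V i)`_j.
Proof.
move=> jm; rewrite coefM; apply: eq_bigr => i _; rewrite coef_poly.
by rewrite (leq_ltn_trans (leq_subr _ _) jm).
Qed.

Lemma conv_mul P Q V j : conv (P * Q) V j = conv P (conv Q V) j.
Proof.
rewrite (conv_poly _ _ (ltnSn j)) -mulrA coefM; apply: eq_bigr => i _.
by rewrite (@conv_poly Q V j.+1)// ltnS leq_subr.
Qed.

Lemma conv_inj Q V y n : Q`_0 != 0 ->
  (forall j, (j < n)%N -> conv Q V j = conv Q y j) ->
  forall j, (j < n)%N -> V j = y j.
Proof.
move=> Q0 H; elim/ltn_ind => j IH jn.
have := H j jn; rewrite /conv !big_ord_recl/= !subn0.
rewrite (eq_bigr (fun i : 'I_j => Q`_(bump 0 i) * y (j - bump 0 i)%N)).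
  by move/addIr/(mulfI Q0).
move=> i _; have ji : (j - bump 0 i < j)%N.
  by rewrite ltn_subrL (leq_ltn_trans _ (ltn_ord i)).
by rewrite IH// (ltn_trans ji).
Qed.

Lemma conv_div_XsubC s (z : C) g K : 0 < s -> s < normc z ->
  (forall j, normc (g j) * s ^+ j <= K) ->
  exists V, (exists K', forall j, normc (V j) * s ^+ j <= K') /\
    forall j, conv ('X - z%:P) V j = g j.
Proof.
move=> s0 sz gK; have z0 := lt_trans s0 sz.
have zn0 : z != 0 by apply: contraTneq z0 => ->; rewrite normc0 ltxx.
(* Comparing coefficients in [(X - z) V = g] gives [V_(j-1) - z V_j = g_j]. *)
pose V := fix V j := if j is j'.+1 then (V j' - g j) / z else - g 0 / z.
have K0 : 0 <= K by apply: le_trans (gK 0);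
  rewrite mulr_ge0 ?normc_ge0 ?exprn_ge0// ltW.
exists V; split.
  (* For [u_j = |V_j| s^j] the recurrence gives [|z| u_(j+1) <= s u_j + K]; this bound is its fixed
     point. *)
  exists (K / (normc z - s)) => j.
  have zs : 0 < normc z - s by rewrite subr_gt0.
  rewrite ler_pdivlMr//.
  elim: j => [|j IH].
    have := gK 0%N; rewrite !expr0 !mulr1/= normcM normcN normcV => h.
    rewrite mulrAC ler_pdivrMr//; apply: ler_pM; rewrite ?normc_ge0//.
      exact: ltW.
    by rewrite lerBlDr lerDl ltW.
  have h : normc (V j.+1) * normc z <= normc (V j) + normc (g j.+1).
    rewrite /= -normcM divfK//; apply: le_trans (le_normcD _ _) _.
    by rewrite normcN.
  have h2 := gK j.+1; have sj : 0 <= s ^+ j.+1 by rewrite exprn_ge0// ltW.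
  have h3 := ler_wpM2r sj h; move: h3 h2 IH; rewrite exprSr.
  move: (normc (V j)) (normc (V j.+1)) (normc (g j.+1)) (s ^+ j) (normc z) zs z0
    {sj h sz}
    => v v' k sj d zs z0 h3 h2 IH.
  rewrite -(ler_pM2r z0).
  have := ler_wpM2r (ltW zs) h3; have := ler_wpM2r (ltW s0) IH.
  have := ler_wpM2r (ltW zs) h2; nra.
elim => [|j _].
  by rewrite /conv big_ord_recl big_ord0 addr0 coefB coefX coefC/= sub0r mulNr
    mulrC divfK// opprK.
rewrite /conv !big_ord_recl/= big1 => [|i _].
  rewrite addr0 !coefB !coefX !coefC/= sub0r subr0 mul1r subn1/=.
  by rewrite mulNr mulrC divfK// opprB subrK.
by rewrite coefB coefX coefC/= subr0 mul0r.
Qed.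

(** All roots of [Q] have modulus greater than [s]; dividing by the linear factors one after the
    other keeps [|V_j| s^j] bounded. *)
Lemma conv_div (Q : {poly C}) s g K : 0 < s ->
  (forall x, normc x <= s -> Q.[x] != 0) ->
  (forall j, normc (g j) * s ^+ j <= K) ->
  exists V, (exists K', forall j, normc (V j) * s ^+ j <= K') /\
    forall j, conv Q V j = g j.
Proof.
move=> s0 Qn; have [rs QE] := closed_field_poly_normal Q.
have Q0 : Q != 0.
  by apply: contraNneq (Qn 0 _) => [->|]; rewrite ?horner0// normc0 ltW.
have rss z : z \in rs -> s < normc z.
  move=> zrs; rewrite ltNge; apply/negP => /Qn.
  by rewrite QE hornerZ mulf_eq0 negb_or -[_.[z] == 0]/(root _ z) root_prod_XsubC
    zrs andbF.
have lc0 : lead_coef Q != 0 by rewrite lead_coef_eq0.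
move: (lead_coef Q) lc0 QE => a a0 -> {Qn Q0}.
elim: rs rss g K => [|z rs IH] rss g K gK.
  exists (fun j => a^-1 * g j); split.
    exists (normc a^-1 * K) => j; rewrite normcM -mulrA ler_wpM2l ?normc_ge0//.
  move=> j; rewrite big_nil alg_polyC /conv big_ord_recl/= coefC subn0 mulVKf//.
  by rewrite big1 ?addr0// => i _; rewrite coefC mul0r.
have [G [[K' GK] Gg]] := conv_div_XsubC s0 (rss z (mem_head _ _)) gK.
have [|V [VK VG]] := IH _ G K' GK.
  by move=> w wrs; apply: rss; rewrite inE wrs orbT.
exists V; split=> // j; rewrite big_cons scalerAr conv_mul -Gg.
by congr (conv _ _ _); apply/funext.
Qed.

Lemma exprn_small (q e : R) : 0 <= q < 1 -> 0 < e ->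
  exists n, forall m, (n <= m)%N -> q ^+ m < e.
Proof.
move=> /andP[q0 q1] e0.
have := cvg_expr (_ : `|q| < 1); rewrite ger0_norm// => /(_ q1).
move=> /cvgrPdist_lt/(_ e e0)[n _ nP]; exists n => m nm.
by have := nP m nm; rewrite sub0r normrN ger0_norm ?exprn_ge0.
Qed.

Lemma normc_sum n (F : 'I_n -> C) : normc (\sum_(i < n) F i) <= \sum_(i < n) normc
  (F i).
Proof.
elim/big_ind2 : _ => [|x1 x2 y1 y2 h1 h2|//]; first by rewrite normc0.
by apply: le_trans (le_normcD _ _) _; exact: lerD.
Qed.

Lemma poly_mul_lowerR (c r : R) (P Q : {poly C}) n : 0 <= r ->
  (size P <= n)%N -> (size (Q * P)%R <= n)%N ->
  0 <= c -> (forall x, normc x = r -> c <= normc Q.[x]) ->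
  c ^+ 2 * \sum_(j < n) (normc P`_j * r ^+ j) ^+ 2 <=
  \sum_(j < n) (normc (Q * P)`_j * r ^+ j) ^+ 2.
Proof.
move=> r0 szP szQP c0 cQ.
have E (p : {poly C}) : \sum_(j < n) `|p`_j * r%:C ^+ j| ^+ 2 =
    (\sum_(j < n) (normc p`_j * r ^+ j) ^+ 2)%:C.
  rewrite rmorph_sum; apply: eq_bigr => j _.
  rewrite rmorphXn/=; congr (_ ^+ 2).
  by rewrite normr_normc normcM -rmorphXn normcR (ger0_norm (exprn_ge0 _ r0)).
have := @poly_mul_lower _ c%:C r%:C P Q n szP szQP.
rewrite !E lecR -rmorphXn -rmorphM lecR; apply=> // x.
by rewrite !normr_normc normcR (ger0_norm r0) => /complexI/cQ; rewrite lecR.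
Qed.

(* Truncating [Q y] at order [n] and dividing by [Q] gives a sequence [V] that
   agrees with [y] below [n] and for which [V_j r^j] decays geometrically, so
   that [poly_mul_lower] applies to long truncations of [V]. *)
Lemma conv_lower Q y c r s n : 0 < c -> 0 < r -> r < s ->
  (forall x, normc x <= s -> Q.[x] != 0) ->
  (forall x, normc x = r -> c <= normc Q.[x]) ->
  c ^+ 2 * \sum_(j < n) (normc (y j) * r ^+ j) ^+ 2 <=
  \sum_(j < n) (normc (conv Q y j) * r ^+ j) ^+ 2.
Proof.
move=> c0 r0 rs Qn Qc; have s0 := lt_trans r0 rs.
pose g j := if (j < n)%N then conv Q y j else 0.
have [K gK] : exists K, forall j, normc (g j) * s ^+ j <= K.
  exists (\sum_(j < n) normc (g j) * s ^+ j) => j.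
  have [jn|nj] := ltnP j n.
    rewrite (bigD1 (Ordinal jn))//= lerDl; apply: sumr_ge0 => i _.
    by rewrite mulr_ge0 ?normc_ge0 ?exprn_ge0// ltW.
  rewrite /g ifN -?leqNgt// normc0 mul0r; apply: sumr_ge0 => i _.
  by rewrite mulr_ge0 ?normc_ge0 ?exprn_ge0// ltW.
have [V [[K' VK] Vg]] := conv_div s0 Qn gK.

have Q0 : Q`_0 != 0 by rewrite -horner_coef0 Qn// normc0 ltW.
have Vy : forall j, (j < n)%N -> V j = y j.
  by apply: (conv_inj Q0) => j jn; rewrite Vg /g jn.
pose q := r / s; have q01 : 0 <= q < 1.
  by rewrite /q divr_ge0 ?(ltW r0) ?(ltW s0)//= ltr_pdivrMr// mul1r.
have K'0 : 0 <= K' by apply: le_trans (VK 0%N); rewrite mulr_ge0 ?normc_ge0.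
have Vq j : normc (V j) * r ^+ j <= K' * q ^+ j.
  have -> : r ^+ j = s ^+ j * q ^+ j.
    by rewrite -exprMn /q mulrCA divff ?mulr1// gt_eqF.
  by rewrite mulrA ler_wpM2r// exprn_ge0//; case/andP: q01.
pose d := size Q; pose A := \sum_(i < d) normc Q`_i * r ^+ i.
have A0 : 0 <= A.
  by apply: sumr_ge0 => i _; rewrite mulr_ge0 ?normc_ge0 ?exprn_ge0// ltW.
(* [V] is cut at [N = n + d + m]. Below [N] the product [Q W] has the coefficients of [g], which are
   zero from [n] on. The [d] coefficients from [N] on are caused by the cut, and each has weighted
   size at most [A K' q^m]. *)
have bound m : c ^+ 2 * \sum_(j < n) (normc (y j) * r ^+ j) ^+ 2 <=
    \sum_(j < n) (normc (conv Q y j) * r ^+ j) ^+ 2 + d%:R * (A * K') ^+ 2 * q ^+ m.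
  pose N := (n + d + m)%N; pose W := \poly_(i < N) V i.
  have nN : (n <= N + d)%N by rewrite /N -!addnA leq_addr.
  have szW : (size W <= N + d)%N.
    by rewrite (leq_trans (size_poly _ _))// leq_addr.
  have szQW : (size (Q * W)%R <= N + d)%N.
    rewrite (leq_trans (size_polyMleq _ _))// (leq_trans (leq_pred _))//.
    by rewrite addnC leq_add2r size_poly.
  have := poly_mul_lowerR (ltW r0) szW szQW (ltW c0) Qc.
  have WV j : (j < N)%N -> W`_j = V j by move=> jN; rewrite coef_poly jN.
  have QWg j : (j < N)%N -> (Q * W)`_j = g j by move=> jN; rewrite -conv_poly// Vg.
  have QWs j : (N <= j)%N -> (normc (Q * W)`_j * r ^+ j) ^+ 2 <= (A * K') ^+ 2 * q ^+ m.
    move=> Nj; have [q0 /ltW q1] := andP q01.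
    have qm i k : (k <= i)%N -> q ^+ i <= q ^+ k by exact: ler_wiXn2l.
    have QWE : (Q * W)`_j = \sum_(i < d) Q`_i * (if (j < i)%N then 0 else W`_(j - i)).
      rewrite -[in LHS](coefK Q) poly_def mulr_suml coef_sum.
      by apply: eq_bigr => i _; rewrite -scalerAl coefZ coefXnM.
    have le : normc (Q * W)`_j * r ^+ j <= A * (K' * q ^+ m).
      rewrite QWE /A mulr_suml.
      have rj := exprn_ge0 j (ltW r0).
      apply: (@le_trans _ _ ((\sum_(i < d) normc (Q`_i *
          (if (j < i)%N then 0 else W`_(j - i)))) * r ^+ j)).
        by rewrite ler_wpM2r// normc_sum.
      rewrite mulr_suml; apply: ler_sum => i _.
      have ij : (i <= j)%N.
        by rewrite (leq_trans (ltnW (ltn_ord i)))// (leq_trans _ Nj)// /N addnAC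
          leq_addl.
      have mji : (m <= j - i)%N.
        rewrite leq_subRL// (leq_trans _ Nj)// /N leq_add2r.
        by rewrite (leq_trans (ltnW (ltn_ord i)))// leq_addl.
      have -> : r ^+ j = r ^+ i * r ^+ (j - i)%N by rewrite -exprD subnKC.
      rewrite ltnNge ij/= normcM mulrACA.
      rewrite ler_wpM2l ?mulr_ge0 ?normc_ge0 ?exprn_ge0 ?(ltW r0)//.
      apply: le_trans (le_trans (Vq (j - i)%N) _).
        rewrite ler_wpM2r ?exprn_ge0 ?(ltW r0)// coef_poly.
        by case: ifP => // _; rewrite normc0 normc_ge0.
      by rewrite ler_wpM2l// qm.
    rewrite (@le_trans _ _ ((A * (K' * q ^+ m)) ^+ 2))//.
      by rewrite lerXn2r ?nnegrE ?mulr_ge0 ?normc_ge0 ?exprn_ge0// ltW.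
    by rewrite mulrA exprMn -exprM ler_wpM2l ?sqr_ge0// qm// muln2 -addnn leq_addr.
  move=> H; apply: le_trans (le_trans H _).
    rewrite ler_wpM2l ?sqr_ge0// (big_ord_widen _ (fun j => (normc (y j) * r ^+ j)
      ^+ 2) nN).
    rewrite big_mkcond/=; apply: ler_sum => j _; case: ifP => [jn|_];
      last exact: sqr_ge0.
    by rewrite WV ?Vy// (leq_trans jn)// /N -addnA leq_addr.
  rewrite big_split_ord/=; apply: lerD.
    have nN' : (n <= N)%N by rewrite /N -addnA leq_addr.
    rewrite (big_ord_widen _ (fun j => (normc (conv Q y j) * r ^+ j) ^+ 2) nN').
    rewrite [leRHS]big_mkcond/=; apply: ler_sum => j _; rewrite QWg// /g.
    by case: ifP => // _; rewrite normc0 mul0r expr0n.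
  have -> : d%:R * (A * K') ^+ 2 * q ^+ m = \sum_(j < d) (A * K') ^+ 2 * q ^+ m.
    by rewrite sumr_const card_ord -mulrA mulr_natl.
  by apply: ler_sum => j _; apply: QWs; rewrite leq_addr.
(* As [m] grows the error term tends to [0]: a failure of the claim by [a - b > 0] contradicts
   [bound] once [X q^m < a - b]. *)
rewrite leNgt; apply/negP => lt.
set X := d%:R * _ in bound.
have X0 : 0 <= X by rewrite mulr_ge0 ?sqr_ge0.
set a := c ^+ 2 * _ in lt bound; set b := \sum_(j < n) _ in lt bound.
have e0 : 0 < (a - b) / (X + 1) by rewrite divr_gt0 ?subr_gt0// ltr_wpDl.
have [m /(_ m (leqnn m)) qm] := exprn_small q01 e0.
have : X * q ^+ m < a - b.
  have [q0 _] := andP q01.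
  apply: (@le_lt_trans _ _ (q ^+ m * (X + 1))).
    by rewrite mulrC ler_wpM2l ?exprn_ge0// lerDl.
  by rewrite -ltr_pdivlMr ?ltr_wpDl.
by rewrite ltrBrDl ltNge bound.
Qed.

End PowerSeriesDivision.

(** * Lower bound for the Euler polynomial *)

Section CharacteristicRectangle.
Context {R : realType}.

(** [|Delta|^2], written as a continuous function on [R * R], attains its minimum on the compact
    rectangle, and it is positive because no root lies there. *)
Lemma charfun_lower (a0 a1 a2 tau1 tau2 x1 x2 y : R) :
  (forall s, x1 <= complex.Re s -> charfun a0 a1 a2 tau1 tau2 s != 0) ->
  x1 <= x2 -> 0 <= y ->
  exists2 c, 0 < c & forall s, x1 <= complex.Re s <= x2 -> `|complex.Im s| <= y ->
    c <= normc (charfun a0 a1 a2 tau1 tau2 s).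
Proof.
move=> Hn x12 y0.
pose e (t : R) (p : R * R) := expR (- p.1 * t).
pose re (p : R * R) := p.1 + a0 + a1 * (e tau1 p * cos (- p.2 * tau1)) +
  a2 * (e tau2 p * cos (- p.2 * tau2)).
pose im (p : R * R) := p.2 + a1 * (e tau1 p * sin (- p.2 * tau1)) +
  a2 * (e tau2 p * sin (- p.2 * tau2)).
pose f (p : R * R) := re p * re p + im p * im p.
have fE p : normc (charfun a0 a1 a2 tau1 tau2 (p.1 +i* p.2)) ^+ 2 = f p.
  rewrite normcE2 /f -!expr2 /re /im /e /=.
  rewrite !mulr0 !mul0r !subr0 !addr0 ?add0r; ring.
pose D := `[x1, x2]%classic `*` `[- y, y]%classic : set (R * R).
have cD : compact D by apply: compact_setX; exact: segment_compact.
have D0 : D !=set0.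
  exists (x1, 0); rewrite /D; split => /=; rewrite in_itv/= ?lexx//.
  by rewrite oppr_le0 y0.
have c1 t : continuous (fun p : R * R => - p.1 * t).
  by move=> p; apply: cvgM; [apply: cvgN; exact: cvg_fst|exact: cvg_cst].
have c2 t : continuous (fun p : R * R => - p.2 * t).
  by move=> p; apply: cvgM; [apply: cvgN; exact: cvg_snd|exact: cvg_cst].
have ce t : continuous (e t).
  by move=> p; apply: cvg_comp; [exact: c1|exact: continuous_expR].
have cc t : continuous (fun p : R * R => cos (- p.2 * t)).
  by move=> p; apply: cvg_comp; [exact: c2|exact: continuous_cos].
have cs t : continuous (fun p : R * R => sin (- p.2 * t)).
  by move=> p; apply: cvg_comp; [exact: c2|exact: continuous_sin].
have cre : continuous re.
  move=> p; apply: cvgD; last by apply: cvgM; [exact: cvg_cst|apply: cvgM;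
    [exact: ce|exact: cc]].
  apply: cvgD; last by apply: cvgM; [exact: cvg_cst|apply: cvgM; [exact: ce|exact: cc]].
  by apply: cvgD; [exact: cvg_fst|exact: cvg_cst].
have cim : continuous im.
  move=> p; apply: cvgD; last by apply: cvgM; [exact: cvg_cst|apply: cvgM;
    [exact: ce|exact: cs]].
  apply: cvgD; last by apply: cvgM; [exact: cvg_cst|apply: cvgM; [exact: ce|exact: cs]].
  exact: cvg_snd.
have cf : {within D, continuous f}.
  apply: continuous_subspaceT => p.
  by apply: cvgD; apply: cvgM; [exact: cre|exact: cre|exact: cim|exact: cim].
have [p pD pmin] := compact_EVT_min D0 cD cf.
have p1 : x1 <= p.1 by move: pD; rewrite inE => -[] /=; rewrite in_itv/= => /andP[].
exists (normc (charfun a0 a1 a2 tau1 tau2 (p.1 +i* p.2))).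
  rewrite lt_neqAle normc_ge0 andbT eq_sym.
  by apply: contra (Hn (p.1 +i* p.2) p1) => /eqP/eq0_normc->.
case=> a b /= ab hb; rewrite -ler_sqr ?nnegrE ?normc_ge0// fE (fE (a, b)).
by apply: pmin; rewrite inE; split => /=; rewrite in_itv//= -ler_norml.
Qed.

(** Take [s = ln |x| + it] with [t = acos (Re x / |x|)], or [-t] in place of [t] when [Im x < 0]. *)
Lemma polar (x : R[i]) : x != 0 -> exists2 s, x = cexp s & `|complex.Im s| <= pi.
Proof.
move=> x0; pose r := normc x.
have r0 : 0 < r.
  by rewrite lt_neqAle normc_ge0 andbT eq_sym; apply: contra x0 => /eqP/eq0_normc->.
have hx : complex.Re x ^+ 2 + complex.Im x ^+ 2 = r ^+ 2 by rewrite -normcE2.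
pose t := complex.Re x / r.
have t1 : -1 <= t <= 1.
  by rewrite -ler_norml normrM normfV (gtr0_norm r0) ler_pdivrMr// mul1r abs_Re_le.
have ct : cos (acos t) = t by rewrite acosK// in_itv.
have st : sin (acos t) = `|complex.Im x| / r.
  rewrite sin_acos//; have -> : 1 - t ^+ 2 = (complex.Im x / r) ^+ 2.
    rewrite /t !exprMn !exprVn; apply: (mulIf (expf_neq0 2 (lt0r_neq0 r0))).
    rewrite mulrBl !divfK ?expf_neq0 ?gt_eqF// mul1r -hx; ring.
  by rewrite sqrtr_sqr normrM normfV (gtr0_norm r0).
have e : expR (ln r) = r by rewrite lnK// posrE.
have rn0 : r != 0 by rewrite gt_eqF.
have api : `|acos t| <= pi by rewrite ger0_norm ?acos_ge0// acos_lepi.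
have [im0|im0] := leP 0 (complex.Im x).
  exists (ln r +i* acos t) => //; rewrite /cexp/= e ct st (ger0_norm im0).
  apply/eqP; rewrite eq_complex/= !mul0r subr0 addr0 ![r * _]mulrC.
  by rewrite /t !(divfK rn0) !eqxx.
exists (ln r +i* - acos t); last by rewrite normrN.
rewrite /cexp/= e cosN sinN ct st (ltr0_norm im0).
apply/eqP; rewrite eq_complex/= !mul0r subr0 addr0 mulNr opprK ![r * _]mulrC.
by rewrite /t !(divfK rn0) !eqxx.
Qed.

Lemma cos_ge_half (u : R) : `|u| <= 1 -> 2^-1 <= cos u.
Proof.
move=> u1; have := cos_ge u.
have : u ^+ 2 <= 1 by rewrite -(real_normK (num_real u)) exprn_ile1.
lra.
Qed.

Lemma sqr_sin_ge (u : R) : `|u| <= 1 -> u ^+ 2 / 4 <= sin u ^+ 2.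
Proof.
wlog u0 : u / 0 <= u.
  move=> H; have [|u0] := leP 0 u; first exact: H.
  by move=> u1; have := H (- u); rewrite oppr_ge0 (ltW u0) normrN sinN !sqrrN; apply.
rewrite (ger0_norm u0) => u1.
move: u0; rewrite le_eqVlt => /predU1P[<-|u0]; first by rewrite sin0; lra.
have [|c] := MVT u0 (fun u _ => is_derive_sin u).
  by apply: continuous_subspaceT; exact: continuous_sin.
rewrite sin0 !subr0 in_itv/= => /andP[c0 cu] ->.
have h : 2^-1 <= cos c.
  by rewrite cos_ge_half// ger0_norm ?(ltW c0)// (le_trans (ltW cu)).
rewrite exprMn mulrC ler_wpM2r ?sqr_ge0// expr2.
by have := ler_pM _ _ h h; rewrite !invr_ge0 => /(_ (ler0n _ 2) (ler0n _ 2)); lra.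
Qed.

(** For [s = a + it], [|1 - e^s|^2 = (1 - e^a)^2 + 4 e^a sin(t/2)^2]. The angle is halved once more
    so that [|t/4| <= 1], which gives [sin(t/2)^2 >= t^2/64]. *)
Lemma norm_1sub_cexp (s : R[i]) : `|complex.Im s| <= pi ->
  expR (complex.Re s) * complex.Im s ^+ 2 / 16 <= normc (1 - cexp s) ^+ 2.
Proof.
case: s => a t ht; rewrite normcE2 /cexp/= !mul0r subr0 addr0 sub0r.
have -> : (1 - expR a * cos t) ^+ 2 + (- (expR a * sin t)) ^+ 2 =
  (1 - expR a) ^+ 2 + 2 * expR a * (1 - cos t) + expR a ^+ 2 * (cos t ^+ 2 + sin t
    ^+ 2 - 1) by ring.
rewrite cos2Dsin2 subrr mulr0 addr0 cos_half.
have ea := expR_gt0 a.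
have u1 : `|t / 4| <= 1.
  rewrite normrM (ger0_norm (_ : 0 <= 4^-1 :> R)) ?invr_ge0//.
  by move: ht => /=; have := pihalf_lt2 R; lra.
have : t ^+ 2 / 64 <= sin (t / 2) ^+ 2.
  have -> : sin (t / 2) = 2 * sin (t / 4) * cos (t / 4).
    by rewrite sin_half (_ : t / 2 / 2 = t / 4)//; field.
  have h1 := sqr_sin_ge u1; have h2 := cos_ge_half u1.
  have h3 : 4^-1 <= cos (t / 4) ^+ 2.
    by have := ler_pM _ _ h2 h2; rewrite !invr_ge0 => /(_ (ler0n _ 2) (ler0n _ 2));
      rewrite -expr2; lra.
  have := ler_pM _ _ h1 h3; rewrite !exprMn; have := sqr_ge0 t.
  by move=> ? /(_ _ _); lra.
by have := sqr_ge0 (1 - expR a); nra.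
Qed.

Section LowerBound.
Variables (a0 a1 a2 tau1 tau2 x1 : R).
Hypotheses (tau1_ge0 : 0 <= tau1) (tau12 : tau1 <= tau2) (x1_le0 : x1 <= 0).
Hypothesis Delta_neq0 : forall s, x1 <= complex.Re s -> charfun a0 a1 a2 tau1 tau2
  s != 0.

(** [X] is the shift by one step [h] and [(1 - X)/h] the backward difference. A delay with
    [J h <= tau <= (J+1) h] is rounded up to [J+1] steps, and the [a0] term takes the previous
    sample, as in the explicit Euler scheme. *)
Definition euler_poly (h : R) (J1 J2 : nat) : {poly R[i]} :=
  h^-1%:C *: (1 - 'X) + a0%:C *: 'X + a1%:C *: 'X^(J1.+1) + a2%:C *: 'X^(J2.+1).

Lemma euler_polyE h J1 J2 x : (euler_poly h J1 J2).[x] =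
  h^-1%:C * (1 - x) + (a0%:C * x + a1%:C * x ^+ J1.+1 + a2%:C * x ^+ J2.+1).
Proof.
by rewrite /euler_poly !(hornerD, hornerZ, hornerN, hornerX, hornerXn, hornerC) !addrA.
Qed.

Let A := `|a0| + `|a1| + `|a2|.

Lemma euler_tail_le J1 J2 x G : normc x <= G -> normc x ^+ J1.+1 <= G ->
  normc x ^+ J2.+1 <= G ->
  normc (a0%:C * x + a1%:C * x ^+ J1.+1 + a2%:C * x ^+ J2.+1) <= A * G.
Proof.
move=> h0 h1 h2; apply: le_trans (le_normcD _ _) _; rewrite /A !mulrDl; apply: lerD.
  apply: le_trans (le_normcD _ _) _; apply: lerD.
    by rewrite normcM normcR ler_wpM2l.
  by rewrite normcM normcR normcX ler_wpM2l.
by rewrite normcM normcR normcX ler_wpM2l.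
Qed.

(** Write [x = e^s] and [w = -s/h], and compare the head [(1 - x)/h] with the tail. If [Re w] or
    [|Im w|] is large, the head dominates. Otherwise [w] lies in a fixed rectangle, where
    [charfun_lower] applies and the polynomial differs from [Delta w] by [O(h)]. *)
Lemma euler_poly_lower : exists c H : R, [/\ 0 < c, 0 < H &
  forall h J1 J2 x, 0 < h <= H -> h *+ J1 <= tau1 <= h *+ J1.+1 ->
    h *+ J2 <= tau2 <= h *+ J2.+1 -> normc x <= expR (- x1 * h) ->
    c <= normc (euler_poly h J1 J2).[x]].
Proof.
(* [G] bounds the powers [|x|^(J+1)] on the disc, as [(J+1) h <= tau2 + 1]. [M] and [Y] are such
   that beyond them the head exceeds the tail by at least [1]. *)
pose M := 2 * A + 2; pose G := expR (- x1 * (tau2 + 1)).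
pose Y := 8 * (A * G + 1).
have A0 : 0 <= A by rewrite !addr_ge0.
have G1 : 1 <= G.
  by rewrite /G -expR0 ler_expR mulr_ge0 ?oppr_ge0// addr_ge0// (le_trans tau1_ge0).
have G0 : 0 <= G by exact: le_trans G1.
have Y0 : 0 <= Y by rewrite mulr_ge0// addr_ge0// mulr_ge0.
have M0 : 0 <= M by rewrite addr_ge0// mulr_ge0.
have [c0 c0_gt0 Dc0] := charfun_lower Delta_neq0 (le_trans x1_le0 M0) Y0.
(* [B] bounds [|w|] on the rectangle, [K h] bounds the distance to [Delta w], and [L] adds up the
   smallness conditions on [h]. *)
pose B := - x1 + M + Y.
have B0 : 0 <= B by rewrite /B; move: M0 Y0 x1_le0; lra.
pose K := 3 * B ^+ 2 + 3 * A * G * B.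
have K0 : 0 <= K by rewrite addr_ge0 ?mulr_ge0 ?sqr_ge0.
pose c := Num.min 1 (c0 / 2).
pose L := 1 + M + 2 * B + 2 * K / c0.
have Kc0 : 0 <= 2 * K / c0 by rewrite divr_ge0 ?(ltW c0_gt0)// mulr_ge0.
have L0 : 0 < L by rewrite /L; have := B0; lra.
exists c, L^-1; split; [by rewrite lt_min ltr01 divr_gt0|by rewrite invr_gt0|].
move=> h J1 J2 x /andP[h0 hL] /andP[J1l J1u] /andP[J2l J2u] hx.
have [h1 hM hB hK] : [/\ h <= 1, M * h <= 1, B * h <= 2^-1 & K * h <= c0 / 2].
  have : L * h <= 1 by rewrite -ler_pdivlMl// mulr1.
  have -> : L * h = h + M * h + 2 * (B * h) + 2 * (K * h / c0) by rewrite /L; ring.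
  have Mh : 0 <= M * h by rewrite mulr_ge0// ltW.
  have Bh : 0 <= B * h by rewrite mulr_ge0// ltW.
  have Kh : 0 <= K * h / c0 by rewrite divr_ge0// ?mulr_ge0// ltW.
  move=> hL1; split; [lra|lra|lra|].
  by rewrite -[leLHS](divfK (lt0r_neq0 c0_gt0)) mulrC ler_wpM2l ?(ltW c0_gt0)//; lra.
have xG J tau : tau <= tau2 -> h *+ J <= tau -> normc x ^+ J.+1 <= G.
  move=> tt Jt; apply: (@le_trans _ _ (expR (- x1 * h) ^+ J.+1)).
    by rewrite lerXn2r ?nnegrE ?normc_ge0 ?expR_ge0.
  rewrite -expRM_natr /G ler_expR -mulrA ler_wpM2l ?oppr_ge0// mulr_natr mulrS addrC.
  by rewrite lerD// (le_trans Jt).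
rewrite euler_polyE.
(* [x = 0] has no logarithm, but there the polynomial equals [1/h >= 1]. *)
have [x0|xn0] := eqVneq x 0.
  rewrite x0 !exprS !mul0r !mulr0 !addr0 subr0 mulr1 normcR ger0_norm ?invr_ge0
    ?(ltW h0)//.
  by rewrite ge_min invf_ge1// h1.
have [s xs ts] := polar xn0.
have xa : normc x = expR (complex.Re s) by rewrite xs normc_cexp.
have tail := @euler_tail_le J1 J2 x.
have hn0 : h != 0 by rewrite gt_eqF.
have nhead : normc (h^-1%:C * (1 - x)) = h^-1 * normc (1 - x).
  by rewrite normcM normcR ger0_norm ?invr_ge0 ?(ltW h0).
have eM : 2^-1 <= expR (- (M * h) / 2) by have := expR_ge1Dx (- (M * h) / 2); lra.
(* If [Re w >= M], then [1 - |x| >= M h / 2]: the head is at least [A + 1] and the tail at most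
   [A]. *)
have [aM|aM] := leP (complex.Re s) (- (M * h)).
  have x_le : normc x <= expR (- (M * h)) by rewrite xa ler_expR.
  have Mh : 0 <= M * h by rewrite mulr_ge0// ltW.
  have x_le1 : normc x <= 1.
    by apply: le_trans x_le _; rewrite expR_le1 oppr_le0.
  have := tail 1 x_le1 (exprn_ile1 _ (normc_ge0 _) x_le1) (exprn_ile1 _ (normc_ge0
    _) x_le1).
  rewrite mulr1 => t1; apply: le_trans (normc_geB _ _).
  rewrite nhead.
  have : M * h / 2 <= normc (1 - x).
    apply: le_trans (_ : 1 - normc x <= _); last first.
      by have := normc_geB 1 (- x); rewrite normc1 normcN.
    have := expR_gt0 (- (M * h)); have := expRxMexpNx_1 (M * h).
    have := expR_ge1Dx (M * h); nra.
  move=> /(ler_wpM2l (_ : 0 <= h^-1)); rewrite invr_ge0 => /(_ (ltW h0)).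
  have -> : h^-1 * (M * h / 2) = A + 1 by rewrite /M; field.
  by move=> h2; rewrite ge_min; apply/orP; left; lra.
(* If [|Im w| >= Y], then [e^(Re s) >= 1/4] and [norm_1sub_cexp] bound the head below by
   [Y / 8 = A G + 1], against a tail of at most [A G]. *)
have [tY|tY] := leP (Y * h) `|complex.Im s|.
  have := tail G (xG 0%N 0 (le_trans tau1_ge0 tau12) (lexx _)) (xG J1 _ tau12 J1l)
    (xG J2 _ (lexx _) J2l).
  move=> tl; apply: le_trans (normc_geB _ _); rewrite nhead.
  have : Y * h / 8 <= normc (1 - x).
    have Yh : 0 <= Y * h / 8 by rewrite divr_ge0// mulr_ge0// ltW.
    rewrite -(ler_sqr _ (normc_ge0 _))// xs.
    apply: le_trans (norm_1sub_cexp ts).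
    have e4 : 4^-1 <= expR (complex.Re s).
      apply: (@le_trans _ _ (expR (- (M * h)))); last by rewrite ler_expR ltW.
      rewrite -[X in expR X](half2 (- (M * h))) expRD.
      by have := ler_pM _ _ eM eM; rewrite !invr_ge0 => /(_ (ler0n _ 2) (ler0n _
        2)); lra.
    have t2 : (Y * h) ^+ 2 <= complex.Im s ^+ 2.
      by rewrite -(real_normK (num_real (complex.Im s))) lerXn2r ?nnegrE//
        mulr_ge0// ltW.
    have := ler_pM _ (sqr_ge0 (Y * h)) e4 t2; rewrite invr_ge0 => /(_ (ler0n _ 4)).
    by move=> h2; rewrite exprMn; lra.
  move=> /(ler_wpM2l (_ : 0 <= h^-1)); rewrite invr_ge0 => /(_ (ltW h0)).
  have -> : h^-1 * (Y * h / 8) = A * G + 1 by rewrite /Y; field.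
  by move=> h2; rewrite ge_min; apply/orP; left; lra.
pose w := - s * h^-1%:C.
have Rew : complex.Re w = - complex.Re s / h by rewrite /w; case: (s) => a b /=;
  rewrite mulr0 subr0.
have Imw : complex.Im w = - complex.Im s / h by rewrite /w; case: (s) => a b /=;
  rewrite mulr0 add0r.
have wM : complex.Re w <= M.
  by rewrite Rew ler_pdivrMr// lerNl ltW.
have x1w : x1 <= complex.Re w.
  rewrite Rew ler_pdivlMr//; move: hx; rewrite xa ler_expR; lra.
have wY : `|complex.Im w| <= Y.
  by rewrite Imw normrM normrN normfV (gtr0_norm h0) ler_pdivrMr// ltW.
have Dw : c0 <= normc (charfun a0 a1 a2 tau1 tau2 w) by apply: Dc0; rewrite ?x1w.
have wB : normc w <= B.
  apply: le_trans (normc_le_add _) _; apply: lerD => //.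
  rewrite ler_norml; apply/andP; split; first by move: M0 x1w x1_le0; lra.
  by move: x1_le0 wM; lra.
have sub1 d : 0 <= d <= h -> normc (cexp (- w * d%:C) - 1) <= 3 * (B * h).
  move=> /andP[d0 dh].
  have n : normc (- w * d%:C) <= B * h.
    by rewrite normcM normcN normcR (ger0_norm d0); apply: ler_pM; rewrite ?normc_ge0.
  by apply: le_trans (cexp_bound1 (le_trans n hB)) _; rewrite ler_wpM2l.
have xw n : x ^+ n = cexp (- w * (h *+ n)%:C).
  rewrite rmorphMn/= mulrnAr cexpMn xs; congr (cexp _ ^+ n).
  by rewrite /w !mulNr opprK -mulrA -rmorphM/= mulVf// mulr1.
(* [(J+1) h - tau] lies in [[0, h]], so the two exponentials differ by a factor [1 + O(h)]. *)
have diff J tau : 0 <= tau <= tau2 -> h *+ J <= tau <= h *+ J.+1 ->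
    normc (x ^+ J.+1 - cexp (- w * tau%:C)) <= G * (3 * (B * h)).
  move=> /andP[ta0 ta2] /andP[l u].
  have -> : x ^+ J.+1 - cexp (- w * tau%:C) =
      cexp (- w * tau%:C) * (cexp (- w * (h *+ J.+1 - tau)%:C) - 1).
    by rewrite mulrBr mulr1 -cexpD xw -mulrDr -rmorphD/= [tau + _]addrC subrK.
  rewrite normcM; apply: ler_pM; rewrite ?normc_ge0//.
    rewrite normc_cexp /G ler_expR.
    have -> : complex.Re (- w * tau%:C) = - complex.Re w * tau.
      by case: (w) => a b /=; rewrite mulr0 subr0.
    apply: (@le_trans _ _ (- x1 * tau)).
      by rewrite ler_wpM2r// lerN2.
    by rewrite ler_wpM2l ?oppr_ge0// (le_trans ta2)// lerDl.
  by apply: sub1; rewrite subr_ge0 u/= lerBlDr; rewrite mulrS lerD2l.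
have xh : cexp (- w * h%:C) = x by rewrite -[RHS]expr1 xw mulr1n.
have E : h^-1%:C * (1 - x) + (a0%:C * x + a1%:C * x ^+ J1.+1 + a2%:C * x ^+ J2.+1) =
  charfun a0 a1 a2 tau1 tau2 w +
  (- (h^-1%:C * (cexp (- w * h%:C) - 1 - (- w * h%:C))) + (a0%:C * (x - 1) +
    a1%:C * (x ^+ J1.+1 - cexp (- w * tau1%:C)) +
    a2%:C * (x ^+ J2.+1 - cexp (- w * tau2%:C)))).
  have hh : h^-1%:C * h%:C = 1 by rewrite -rmorphM/= mulVf.
  have -> : h^-1%:C * (1 - x) = w - h^-1%:C * (x - 1 - (- w * h%:C)) +
    w * (h^-1%:C * h%:C - 1) by ring.
  rewrite hh subrr mulr0 addr0 /charfun xh.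
  move: (cexp _) (cexp _) (x ^+ _) (x ^+ _) => E1 E2 X1 X2; ring.
rewrite E; apply: le_trans (normc_geB _ _).
have : normc (- (h^-1%:C * (cexp (- w * h%:C) - 1 - (- w * h%:C))) + (a0%:C * (x - 1) +
    a1%:C * (x ^+ J1.+1 - cexp (- w * tau1%:C)) +
    a2%:C * (x ^+ J2.+1 - cexp (- w * tau2%:C)))) <= K * h.
  have -> : K * h = h^-1 * (3 * (B * h) ^+ 2) + (`|a0| * (G * (3 * (B * h))) +
      `|a1| * (G * (3 * (B * h))) + `|a2| * (G * (3 * (B * h)))).
    by rewrite /K /A; field.
  have BG : 3 * (B * h) <= G * (3 * (B * h)).
    by rewrite ler_peMl// mulr_ge0// mulr_ge0// ltW.
  have t20 : 0 <= tau2 by exact: le_trans tau12.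
  apply: le_trans (le_normcD _ _) _; apply: lerD.
    rewrite normcN normcM normcR ger0_norm ?invr_ge0 ?(ltW h0)//.
    rewrite ler_wpM2l ?invr_ge0 ?(ltW h0)//.
    have n : normc (- w * h%:C) <= B * h.
      by rewrite normcM normcN normcR (gtr0_norm h0); apply: ler_pM;
        rewrite ?normc_ge0// ltW.
    apply: le_trans (cexp_bound (le_trans n hB)) _.
    by rewrite ler_wpM2l// lerXn2r ?nnegrE ?normc_ge0// mulr_ge0// ltW.
  apply: le_trans (le_normcD _ _) _; apply: lerD; last first.
    by rewrite normcM normcR ler_wpM2l// diff ?J2l ?t20 ?lexx.
  apply: le_trans (le_normcD _ _) _; apply: lerD; last first.
    by rewrite normcM normcR ler_wpM2l// diff ?J1l ?tau1_ge0.
  rewrite normcM normcR ler_wpM2l//; apply: le_trans BG.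
  by rewrite -xh sub1// lexx ltW.
have : c <= c0 / 2 by rewrite ge_min lexx orbT.
move: Dw hK; clear; move: (normc _) (normc _) => u v; lra.
Qed.
End LowerBound.

End CharacteristicRectangle.

(** * Absorption of the residual *)

Section Absorption.
Context {R : realType}.
Implicit Types (M Y F : nat -> R).

Lemma shifted_sum_le (G : nat -> R) q k n : (forall i, 0 <= G i) -> (k <= q)%N ->
  \sum_(j < n | (q <= j)%N) G (j - k)%N <= \sum_(j < n) G j.
Proof.
move=> G0 kq.
have mono m1 m2 : (m1 <= m2)%N -> \sum_(j < m1) G j <= \sum_(j < m2) G j.
  move=> m12; rewrite (big_ord_widen _ _ m12) big_mkcond/=.
  by apply: ler_sum => i _; case: ifP.
apply: (@le_trans _ _ (\sum_(j < n - k) G j)); last by rewrite mono// leq_subr.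
elim: n => [|n IH]; first by rewrite !big_ord0.
rewrite big_mkcond big_ord_recr -big_mkcond/=; case: ifP => qn.
  by rewrite subSn ?(leq_trans kq)// big_ord_recr lerD2r.
by rewrite addr0 (le_trans IH)// mono// leq_sub2r.
Qed.

(** After exchanging the sums, each shift by [k < q] costs at most a factor [r^(2q)]. *)
Lemma window_sum M (r : R) q n : 1 <= r ->
  \sum_(j < n | (q <= j)%N) (\sum_(k < q) M (j - k)%N ^+ 2) * r ^+ j ^+ 2 <=
  q%:R * r ^+ q ^+ 2 * \sum_(j < n) (M j * r ^+ j) ^+ 2.
Proof.
move=> r1; have r0 : 0 <= r by exact: le_trans r1.
under eq_bigr => j _ do rewrite mulr_suml.
rewrite exchange_big/= -mulrA mulr_natl -[X in _ *+ X]card_ord -sumr_const.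
apply: ler_sum => k _.
pose G i := (M i * r ^+ i) ^+ 2.
apply: le_trans (ler_wpM2l (sqr_ge0 (r ^+ q))
  (@shifted_sum_le G q k n (fun=> sqr_ge0 _) (ltnW (ltn_ord k)))).
rewrite mulr_sumr; apply: ler_sum => j qj.
have kj : (k <= j)%N by exact: leq_trans (ltnW (ltn_ord k)) qj.
rewrite /G exprMn [leRHS]mulrCA ler_wpM2l ?sqr_ge0//.
rewrite -{1}(subnK kj) exprD exprMn mulrC ler_wpM2r ?sqr_ge0//.
by rewrite lerXn2r ?nnegrE ?exprn_ge0// ler_weXn2l// ltnW.
Qed.

Lemma sum_split (G H : nat -> R) (d : R) q n :
  (forall j, (j < q)%N -> G j <= d) -> 0 <= d ->
  (forall j, (q <= j)%N -> G j <= H j) ->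
  \sum_(j < n) G j <= q%:R * d + \sum_(j < n | (q <= j)%N) H j.
Proof.
move=> Gd d0 GH; rewrite (bigID (fun j : 'I_n => (q <= j)%N))/= addrC; apply: lerD.
  under eq_bigl do rewrite -ltnNge.
  apply: (@le_trans _ _ (\sum_(j < n | (j < q)%N) d)).
    by apply: ler_sum => j; exact: Gd.
  rewrite -(big_mkord (fun j => j < q)%N (fun=> d)).
  apply: (@le_trans _ _ (\sum_(0 <= j < q) d)); last first.
    by rewrite sumr_const_nat subn0 mulr_natl.
  have [nq|qn] := leqP n q.
    rewrite (big_cat_nat (n := n) (p := q))//= -[leLHS]addr0 lerD//.
      by rewrite [leLHS]big_mkcond; apply: ler_sum => i _; case: ifP.
    exact: sumr_ge0.
  rewrite (big_nat_widen _ _ _ _ _ (ltnW qn)).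
  by [].
by apply: ler_sum => j; exact: GH.
Qed.

(** Meant for cell suprema [M], samples [Y] and residuals [F]. By [window_sum] the terms in [al] and
    [be] contribute at most half of the left-hand sum, which is subtracted. What remains comes from
    the first [q] indices and does not depend on [n]. *)
Lemma absorption M Y F (r c al be d d' : R) q :
  1 <= r -> 0 < c -> 0 <= al -> 0 <= be ->
  (forall j, (j < q)%N -> `|M j| <= d) -> (forall j, (j < q)%N -> `|F j| <= d') ->
  (forall j, (q <= j)%N -> M j ^+ 2 <= 2 * Y j ^+ 2 + al * \sum_(k < q) M (j - k)%N
    ^+ 2) ->
  (forall j, (q <= j)%N -> F j ^+ 2 <= be * \sum_(k < q) M (j - k)%N ^+ 2) ->
  (forall n, c ^+ 2 * \sum_(j < n) (Y j * r ^+ j) ^+ 2 <= \sum_(j < n) (F j * r ^+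
    j) ^+ 2) ->
  (al + 2 * be / c ^+ 2) * (q%:R * r ^+ q ^+ 2) <= 2^-1 ->
  forall n, \sum_(j < n) (M j * r ^+ j) ^+ 2 <=
    2 * (q%:R * r ^+ q ^+ 2 * (d ^+ 2 + 2 * d' ^+ 2 / c ^+ 2)).
Proof.
move=> r1 c0 al0 be0 Md Fd MY FM YF small n.
have r0 : 0 <= r by exact: le_trans r1.
set L := q%:R * r ^+ q ^+ 2 in small *.
set B := \sum_(j < n) _.
have W := window_sum M q n r1; rewrite -/L -/B in W.
have init (G : nat -> R) e : (forall j, (j < q)%N -> `|G j| <= e) ->
    forall j, (j < q)%N -> (G j * r ^+ j) ^+ 2 <= r ^+ q ^+ 2 * e ^+ 2.
  move=> Ge j jq; rewrite exprMn mulrC; apply: ler_pM; rewrite ?sqr_ge0//.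
    by rewrite lerXn2r ?nnegrE ?exprn_ge0// ler_weXn2l// ltnW.
  by rewrite -(real_normK (num_real (G j))) lerXn2r ?nnegrE ?(le_trans _ (Ge j
    jq))// Ge.
have hM : B <= L * d ^+ 2 + (2 * \sum_(j < n) (Y j * r ^+ j) ^+ 2 + al * (L * B)).
  rewrite /L -mulrA.
  apply: le_trans (sum_split (H := fun j => 2 * (Y j * r ^+ j) ^+ 2 +
      al * ((\sum_(k < q) M (j - k)%N ^+ 2) * r ^+ j ^+ 2)) n (init _ _ Md) _ _) _.
  - by rewrite mulr_ge0 ?sqr_ge0.
  - move=> j qj; have := ler_wpM2r (sqr_ge0 (r ^+ j)) (MY j qj).
    by rewrite !exprMn mulrDl !mulrA.
  - rewrite lerD2l big_split/= -!mulr_sumr; apply: lerD; last by rewrite ler_wpM2l.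
    rewrite ler_wpM2l// [leLHS]big_mkcond/=; apply: ler_sum => j _.
    by case: ifP => // _; rewrite sqr_ge0.
have hF : \sum_(j < n) (F j * r ^+ j) ^+ 2 <= L * d' ^+ 2 + be * (L * B).
  rewrite {1}/L -mulrA.
  apply: le_trans (sum_split (H := fun j =>
      be * ((\sum_(k < q) M (j - k)%N ^+ 2) * r ^+ j ^+ 2)) n (init _ _ Fd) _ _) _.
  - by rewrite mulr_ge0 ?sqr_ge0.
  - move=> j qj; have := ler_wpM2r (sqr_ge0 (r ^+ j)) (FM j qj).
    by rewrite !exprMn !mulrA.
  - by rewrite lerD2l -!mulr_sumr ler_wpM2l.
have hY : \sum_(j < n) (Y j * r ^+ j) ^+ 2 <= (L * d' ^+ 2 + be * (L * B)) / c ^+ 2.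
  by rewrite ler_pdivlMr ?exprn_gt0// mulrC (le_trans (YF n)).
have B0 : 0 <= B by apply: sumr_ge0 => j _; exact: sqr_ge0.
have := ler_wpM2r B0 small.
have E : (al + 2 * be / c ^+ 2) * L * B =
  al * (L * B) + 2 * (be * (L * B) / c ^+ 2) by ring.
rewrite {}E mulrDl in hY *.
have -> : L * (d ^+ 2 + 2 * d' ^+ 2 / c ^+ 2) = L * d ^+ 2 + 2 * (L * d' ^+ 2 / c
  ^+ 2) by ring.
move: hM hY; clearbody B L; clear; lra.
Qed.

End Absorption.

(** * Trajectories of the delay equation *)

Section SupNorm.
Context {R : realType}.
Implicit Types (f : R -> R) (u v t K : R).

Definition sup_norm f u v : R := sup [set `|f x| | x in `[u, v]].

Lemma sup_norm_ub f u v t : {within `[u, v], continuous f} -> u <= t <= v ->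
  `|f t| <= sup_norm f u v.
Proof.
move=> cf utv; have uv : u <= v by case/andP: utv => /le_trans; apply.
have cn : {within `[u, v], continuous (fun x => `|f x|)}.
  by move=> x; apply: cvg_comp; [exact: cf|exact: norm_continuous].
have [c _ cmax] := EVT_max uv cn.
apply: ub_le_sup; last by exists t; rewrite //= in_itv.
by exists `|f c| => _ /= [x xuv <-]; apply: cmax.
Qed.

Lemma sup_norm_le f u v K : u <= v -> (forall t, u <= t <= v -> `|f t| <= K) ->
  sup_norm f u v <= K.
Proof.
move=> uv fK; apply: ge_sup.
  by exists `|f u|, u => //=; rewrite in_itv/= lexx.
by move=> _ /= [x xuv <-]; apply: fK; move: xuv; rewrite in_itv.
Qed.

End SupNorm.

Section Trajectory.
Context {R : realType}.
Variables (a0 a1 a2 tau1 tau2 : R) (phi y : R -> R).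
Hypotheses (tau1_gt0 : 0 < tau1) (tau12 : tau1 < tau2).
Hypothesis phi_cont : {within `[- tau2, 0], continuous phi}.
Hypothesis sol : dde_solution a0 a1 a2 tau1 tau2 phi y.

Let A := `|a0| + `|a1| + `|a2|.
Let D := sup_norm phi (- tau2) 0.
Let A0 : 0 <= A. Proof. by rewrite !addr_ge0. Qed.
Let tau2_gt0 : 0 < tau2. Proof. exact: lt_trans tau12. Qed.

Lemma sol_cont u v : - tau2 <= u -> {within `[u, v], continuous y}.
Proof.
move=> tu; have [yc _ _] := sol; apply: continuous_subspaceW yc => x /=.
by rewrite !in_itv/= andbT => /andP[ux _]; exact: le_trans ux.
Qed.

Lemma sol_init t : - tau2 <= t <= 0 -> `|y t| <= D.
Proof. by move=> tt; have [_ -> // _] := sol; exact: sup_norm_ub. Qed.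

Lemma sol_MVT u v : 0 <= u -> u < v -> exists2 x, u < x < v &
  y v - y u = - (a0 * y x + a1 * y (x - tau1) + a2 * y (x - tau2)) * (v - u).
Proof.
move=> u0 uv; have [_ _ yd] := sol.
have der x : x \in `]u, v[ -> is_derive x 1 y (derive1 y x).
  rewrite in_itv/= => /andP[ux _]; have [yx _] := yd x (le_lt_trans u0 ux).
  by rewrite derive1E; exact: derivableP.
have cont : {within `[u, v], continuous y}.
  by apply: sol_cont; rewrite (le_trans _ u0)// oppr_le0 ltW.
have [x xuv e] := MVT uv der cont.
have {}xuv : u < x < v by rewrite in_itv in xuv.
exists x => //; rewrite e; congr (_ * _).
have [_ /eqP] := yd x (le_lt_trans u0 (proj1 (andP xuv))).
by rewrite -!addrA addr_eq0 => /eqP.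
Qed.

Lemma sol_osc u v K : 0 <= u <= v -> (forall t, u - tau2 <= t <= v -> `|y t| <= K) ->
  `|y v - y u| <= A * K * (v - u).
Proof.
move=> /andP[u0]; rewrite le_eqVlt => /predU1P[<-|uv] yK.
  by rewrite !subrr mulr0 normr0.
have [x /andP[ux xv] ->] := sol_MVT u0 uv.
rewrite normrM normrN (ger0_norm (_ : 0 <= v - u)) ?subr_ge0 ?(ltW uv)//.
rewrite ler_wpM2r ?subr_ge0 ?(ltW uv)//.
have yK' t : 0 <= t <= tau2 -> `|y (x - t)| <= K.
  move=> /andP[t0 tt]; apply: yK; rewrite lerB ?(ltW ux)//=.
  by rewrite lerBlDr (le_trans (ltW xv))// lerDl.
have yK0 : `|y x| <= K by rewrite -[x]subr0 yK'// lexx ltW.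
apply: le_trans (ler_normD _ _) _; rewrite /A !mulrDl; apply: lerD; last first.
  by rewrite normrM ler_wpM2l// yK'// lexx ltW.
apply: le_trans (ler_normD _ _) _; rewrite !normrM; apply: lerD; rewrite ler_wpM2l//.
by apply: yK'; rewrite !ltW.
Qed.

(** Over one step of length [h] the solution varies by at most [A h S <= S/2], where [S] is its
    supremum up to the end of the step. So [S <= 2^k D + S/2], and the bound doubles with each
    step. *)
Lemma sol_growth h k t : 0 < h -> A * h <= 2^-1 -> - tau2 <= t <= h *+ k ->
  `|y t| <= 2 ^+ k * D.
Proof.
move=> h0 Ah; elim: k t => [|k IH] t tk; first by rewrite mul1r; exact: sol_init.
have hk0 : 0 <= h *+ k by rewrite mulrn_wge0// ltW.
have hkS : h *+ k.+1 = h *+ k + h by rewrite mulrSr.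
set S := sup_norm y (- tau2) (h *+ k.+1).
have yS x : - tau2 <= x <= h *+ k.+1 -> `|y x| <= S.
  by apply: sup_norm_ub; exact: sol_cont.
suff SD : S <= 2 ^+ k.+1 * D by exact: le_trans (yS t tk) SD.
have tau2N : - tau2 <= 0 by rewrite oppr_le0 ltW.
have S0 : 0 <= S by apply: le_trans (yS 0 _) => //; rewrite tau2N mulrn_wge0// ltW.
suff : S <= 2 ^+ k * D + 2^-1 * S by rewrite exprS; lra.
apply: sup_norm_le => [|x /andP[x1 x2]].
  by rewrite (le_trans tau2N)// mulrn_wge0// ltW.
have [xk|kx] := leP x (h *+ k).
  by rewrite ler_wpDr ?mulr_ge0// IH// x1.
have -> : y x = y (h *+ k) + (y x - y (h *+ k)) by rewrite addrC subrK.
apply: le_trans (ler_normD _ _) _; apply: lerD.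
  by rewrite IH// lexx andbT (le_trans tau2N).
apply: le_trans (sol_osc (K := S) _ _) _.
- by rewrite hk0 ltW.
- move=> u /andP[u1 u2]; apply: yS; rewrite (le_trans u2)// andbT.
  by rewrite (le_trans _ u1)// -[leLHS]add0r lerD2r.
- rewrite -mulrA mulrCA mulrC ler_wpM2r//; apply: le_trans Ah.
  by rewrite ler_wpM2l// lerBlDr addrC -hkS.
Qed.

End Trajectory.

(** * Sampled trajectories *)

Section ConvEuler.
Context {R : realType}.

Lemma conv_euler (a0 a1 a2 h : R) J1 J2 (Y : nat -> R) j :
  (J1 < j)%N -> (J2 < j)%N ->
  conv (euler_poly a0 a1 a2 h J1 J2) (fun i => (Y i)%:C) j =
  (h^-1 * (Y j - Y j.-1) + (a0 * Y j.-1 + a1 * Y (j - J1.+1)%N +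
     a2 * Y (j - J2.+1)%N))%:C.
Proof.
move=> J1j J2j; rewrite (conv_poly _ _ (ltnSn j)) /euler_poly.
set W := \poly_(i < j.+1) _.
have WE i : (i <= j)%N -> W`_i = (Y i)%:C by move=> ij; rewrite coef_poly ltnS ij.
have j0 : (0 < j)%N by exact: leq_ltn_trans J1j.
rewrite !mulrDl -!scalerAl mulrBl mul1r !coefD !coefZ coefB !coefXnM coefXM.
have nJ J : (J < j)%N -> (j < J.+1)%N = false by move=> Jj; rewrite ltnNge Jj.
rewrite gtn_eqF// !nJ//= !WE ?leq_subr ?leq_pred//.
by rewrite -rmorphB -!rmorphM -!rmorphD/= !addrA.
Qed.

Lemma conv_bound (Q : {poly R[i]}) (Y : nat -> R) q K j : (j < q)%N ->
  (forall i, (i < q)%N -> `|Y i| <= K) ->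
  normc (conv Q (fun i => (Y i)%:C) j) <= (\sum_(i < q) normc Q`_i) * K.
Proof.
move=> jq YK; apply: le_trans (normc_sum _) _.
rewrite (big_ord_widen _ (fun i => normc (Q`_i * (Y (j - i)%N)%:C)) jq).
rewrite big_mkcond mulr_suml; apply: ler_sum => i _.
have K0 : 0 <= K by exact: le_trans (YK _ jq).
case: ifP => _; last by rewrite mulr_ge0// normc_ge0.
by rewrite normcM normcR ler_wpM2l ?normc_ge0// YK// (leq_ltn_trans (leq_subr _ _)).
Qed.

End ConvEuler.

Lemma window_index m j : (2 * m + 3 <= j)%N ->
  ((j - (2 * m + 3)).+1 + m <= j - (m + 2))%N.
Proof. by move=> qj; lia. Qed.

Lemma window_pred m j : (2 * m + 3 <= j)%N -> ((j - (m + 2)).+1 <= j)%N.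
Proof. by move=> qj; lia. Qed.

Lemma window_start m j : (2 * m + 3 <= j)%N -> (m + 2 <= j)%N.
Proof. by move=> qj; lia. Qed.

Section Sampling.
Context {R : realType}.
Variables (a0 a1 a2 tau1 tau2 : R) (phi y : R -> R).
Hypotheses (tau1_gt0 : 0 < tau1) (tau12 : tau1 < tau2).
Hypothesis phi_cont : {within `[- tau2, 0], continuous phi}.
Hypothesis sol : dde_solution a0 a1 a2 tau1 tau2 phi y.
Variables (m J1 : nat).
Hypothesis m_gt0 : (0 < m)%N.
Let h : R := tau2 / m%:R.
Hypotheses (J1_le : h *+ J1 <= tau1) (J1_ge : tau1 <= h *+ J1.+1).
Let A := `|a0| + `|a1| + `|a2|.
Hypothesis hA : A * h <= 2^-1.
Let D := sup_norm phi (- tau2) 0.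
(** The residual at index [j] reaches back [m + 2] steps: the delay, its rounding and the
    intermediate point of the mean value theorem. Bounding oscillations there through the equation
    takes another delay of [m] steps. *)
Let q := (2 * m + 3)%N.

Let A0 : 0 <= A. Proof. by rewrite !addr_ge0. Qed.
Let tau2_gt0 : 0 < tau2. Proof. exact: lt_trans tau12. Qed.
Let h_gt0 : 0 < h. Proof. by rewrite divr_gt0// ltr0n. Qed.
Let hm : h *+ m = tau2.
Proof. by rewrite -mulr_natr divfK// pnatr_eq0 -lt0n. Qed.
Let h_le : h <= tau2.
Proof. by rewrite -hm -[leLHS]mulr1n ler_wpMn2l// ltW. Qed.
Let J1m : (J1 < m)%N.
Proof.
rewrite -(ltr_pMn2l h_gt0) hm; exact: le_lt_trans tau12.
Qed.

(** The cell [i] is [[(i-1) h, i h]]; cell [0] lies in the initial interval because [h <= tau2].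
    [T j] is the squared [l^2] norm over the last [q] cells. *)
Let M i := sup_norm y (h *+ i - h) (h *+ i).
Let Y i := y (h *+ i).
Let T j := \sum_(k < q) M (j - k)%N ^+ 2.

Lemma cell_ub i t : h *+ i - h <= t <= h *+ i -> `|y t| <= M i.
Proof.
apply: sup_norm_ub; apply: (sol_cont sol).
by rewrite lerBrDl (le_trans (_ : _ <= 0)) ?mulrn_wge0 ?(ltW h_gt0)// subr_le0.
Qed.

Lemma cell_ge0 i : 0 <= M i.
Proof.
by apply: le_trans (normr_ge0 _) (@cell_ub i (h *+ i) _); rewrite lexx gerBl ltW.
Qed.

Lemma window_ub j t : (q <= j)%N -> h *+ (j - q).+1 <= t <= h *+ j ->
  `|y t| <= Num.sqrt (T j).
Proof.
move=> qj /andP[t1 t2].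
have hj0 : 0 <= (h *+ j - t) / h by rewrite divr_ge0 ?subr_ge0// ltW.
pose k := Num.truncn ((h *+ j - t) / h).
have /andP[k1 k2] := truncn_itv hj0; rewrite -/k in k1 k2.
move: k1 k2; rewrite ler_pdivlMr// ltr_pdivrMr// !mulr_natl => k1 k2.
have kq : (k < q)%N.
  rewrite -ltnS -(ltr_pMn2l h_gt0).
  have -> : h *+ q.+1 = h *+ q + h by rewrite mulrSr.
  have : h *+ j = h *+ (j - q) + h *+ q by rewrite -mulrnDr subnK.
  move: t1; rewrite mulrSr; move: k1; lra.
have kj : (k <= j)%N by exact: leq_trans (ltnW kq) qj.
have yM : `|y t| <= M (j - k)%N.
  apply: cell_ub; rewrite mulrnBr//.
  by move: k2; rewrite mulrSr; move: k1 => ? ?; apply/andP; split; lra.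
rewrite -(ger0_norm (sqrtr_ge0 (T j))) -ler_sqr ?nnegrE//.
rewrite [`|Num.sqrt _|]ger0_norm ?sqrtr_ge0// sqr_sqrtr; last first.
  by apply: sumr_ge0 => i _; exact: sqr_ge0.
rewrite /T (bigD1 (Ordinal kq))//= ler_wpDr//;
  last by rewrite lerXn2r ?nnegrE ?cell_ge0.
by apply: sumr_ge0 => i _; exact: sqr_ge0.
Qed.

Lemma window_osc j u v : (q <= j)%N -> h *+ (j - (m + 2)) <= u <= h *+ j ->
  h *+ (j - (m + 2)) <= v <= h *+ j -> `|v - u| <= h ->
  `|y v - y u| <= A * Num.sqrt (T j) * h.
Proof.
move=> qj; wlog uv : u v / u <= v => [H uj vj d|].
  have [uv|vu] := leP u v; first exact: H.
  by rewrite distrC; apply: H; rewrite // ?(ltW vu)// distrC.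
move=> /andP[u1 u2] /andP[v1 v2]; rewrite ger0_norm ?subr_ge0// => d.

apply: le_trans (@sol_osc R a0 a1 a2 tau1 tau2 phi y tau1_gt0 tau12 sol u v
  (Num.sqrt (T j)) _ _) _.
- by rewrite uv andbT (le_trans _ u1)// mulrn_wge0// ltW.
- move=> t /andP[t1 t2]; apply: window_ub => //; rewrite (le_trans t2)// andbT.
  apply: le_trans t1; rewrite -hm lerBrDr -mulrnDr (le_trans _ u1)//.
  by rewrite ler_wpMn2l ?(ltW h_gt0)// (window_index qj).
- by rewrite ler_wpM2l// mulr_ge0// sqrtr_ge0.
Qed.

Lemma sample_growth j t : (j < q)%N -> h *+ j - h <= t <= h *+ j ->
  `|y t| <= 2 ^+ q * D.
Proof.
move=> jq /andP[t1 t2].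
have Ah : A * h <= 2^-1 by [].
apply: (@sol_growth R a0 a1 a2 tau1 tau2 phi y tau1_gt0 tau12 phi_cont sol h q t
  h_gt0 Ah).
apply/andP; split.
  apply: le_trans t1; rewrite lerBrDl (le_trans (_ : _ <= 0)) ?mulrn_wge0 ?(ltW
    h_gt0)//.
  by rewrite subr_le0.
by rewrite (le_trans t2)// ler_wpMn2l ?(ltW h_gt0)// ltnW.
Qed.

Lemma D_ge0 : 0 <= D.
Proof.
apply: le_trans (normr_ge0 (y 0)) _; apply: (sol_init phi_cont sol).
by rewrite lexx oppr_le0 ltW.
Qed.

Lemma cell_le j : (q <= j)%N ->
  M j ^+ 2 <= 2 * `|Y j| ^+ 2 + 2 * (h * A) ^+ 2 * T j.
Proof.
move=> qj; have T0 : 0 <= T j by apply: sumr_ge0 => i _; exact: sqr_ge0.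
have MY : M j <= `|Y j| + A * Num.sqrt (T j) * h.
  apply: sup_norm_le => [|t /andP[t1 t2]]; first by rewrite gerBl ltW.
  have -> : y t = Y j + (y t - Y j) by rewrite addrC subrK.
  apply: le_trans (ler_normD _ _) _; rewrite lerD2l.
  apply: window_osc => //.
  - by rewrite lexx andbT ler_wpMn2l ?(ltW h_gt0)// leq_subr.
  - rewrite t2 andbT; apply: le_trans t1.
    rewrite lerBrDr -mulrSr ler_wpMn2l ?(ltW h_gt0)//.
    exact: window_pred qj.
  - by rewrite distrC ger0_norm ?subr_ge0// lerBlDr -lerBlDl.
have MY2 : M j ^+ 2 <= (`|Y j| + A * Num.sqrt (T j) * h) ^+ 2.
  by rewrite lerXn2r ?nnegrE ?cell_ge0// (le_trans _ MY)// cell_ge0.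
apply: le_trans MY2 _.
rewrite -{2}(sqr_sqrtr T0).
by have := sqr_ge0 (`|Y j| - A * Num.sqrt (T j) * h); lra.
Qed.

(** By the mean value theorem the difference quotient is given by the equation at some [x] between
    [(j-1) h] and [j h]. The residual is then a combination of differences of [y] at points at most
    [h] apart, each bounded by [window_osc]. *)
Lemma residual_le j : (q <= j)%N ->
  normc (conv (euler_poly a0 a1 a2 h J1 m) (fun i => (Y i)%:C) j) ^+ 2 <=
  (h * A ^+ 2) ^+ 2 * T j.
Proof.
move=> qj; have T0 : 0 <= T j by apply: sumr_ge0 => i _; exact: sqr_ge0.
have mj : (m + 2 <= j)%N by exact: window_start qj.
have J1j : (J1 < j)%N by apply: leq_trans mj; rewrite (leq_trans J1m)// leq_addr.
have mj' : (m < j)%N by apply: leq_trans mj; rewrite addn2 ltnW.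
have j0 : (0 < j)%N by exact: leq_ltn_trans mj'.
rewrite conv_euler// normcR.
have hjS : h *+ j = h *+ j.-1 + h by rewrite -mulrSr prednK.
have hj0 : 0 <= h *+ j.-1 by rewrite mulrn_wge0// ltW.
have hjlt : h *+ j.-1 < h *+ j by rewrite hjS ltrDl.
have [x /andP[x1 x2] e] := @sol_MVT R a0 a1 a2 tau1 tau2 phi y tau1_gt0 tau12 sol
  (h *+ j.-1) (h *+ j) hj0 hjlt.
have lo J : (J <= m)%N -> h *+ (j - (m + 2)) <= h *+ j - h *+ J - h - h.
  move=> Jm; rewrite mulrnBr// mulrnDr mulr2n.
  by have := ler_wpMn2l (ltW h_gt0) Jm; lra.
have hjJ J : (J <= m)%N -> h *+ (j - J.+1) = h *+ j - h *+ J - h.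
  move=> Jm; rewrite mulrnBr ?mulrSr ?opprD ?addrA//.
  exact: leq_ltn_trans mj'.
have K0 : 0 <= A * Num.sqrt (T j) * h by rewrite !mulr_ge0 ?sqrtr_ge0// ltW.
(* [x - tau] lies between [(j-J-2) h] and [(j-J) h], an interval centred at the sampling point
   [(j-J-1) h]; this is why delays are rounded up to [J+1] steps. *)
have osc J tau : (J <= m)%N -> h *+ J <= tau <= h *+ J.+1 ->
    `|Y (j - J.+1)%N - y (x - tau)| <= A * Num.sqrt (T j) * h.
  move=> Jm /andP[l]; rewrite mulrSr => u.
  have := lo J Jm; have := hjJ J Jm; rewrite /Y => -> lo1.
  have J0 : 0 <= h *+ J by rewrite mulrn_wge0// ltW.
  apply: window_osc => //.
  - by apply/andP; split; move: lo1 x1 x2 l u J0 h_gt0 hjS; lra.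
  - by apply/andP; split; move: lo1 x1 x2 l u J0 h_gt0 hjS; lra.
  - by rewrite ler_norml; apply/andP; split; move: lo1 x1 x2 l u J0 h_gt0 hjS; lra.
have osc0 : `|Y j.-1 - y x| <= A * Num.sqrt (T j) * h.
  have := osc 0%N 0 (leq0n m); rewrite !subr0 subn1; apply.
  by rewrite mulr0n lexx mulr1n ltW.
have -> : h^-1 * (Y j - Y j.-1) + (a0 * Y j.-1 + a1 * Y (j - J1.+1)%N +
    a2 * Y (j - m.+1)%N) = a0 * (Y j.-1 - y x) + a1 * (Y (j - J1.+1)%N - y (x - tau1)) +
    a2 * (Y (j - m.+1)%N - y (x - tau2)).
  rewrite {1}/Y e hjS [h *+ j.-1 + h]addrC addrK mulrCA mulVf ?gt_eqF// mulr1; ring.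
move: osc osc0 K0; set K := A * Num.sqrt (T j) * h => osc osc0 K0.
have F1 : `|a0 * (Y j.-1 - y x) + a1 * (Y (j - J1.+1)%N - y (x - tau1)) +
    a2 * (Y (j - m.+1)%N - y (x - tau2))| <= A * K.
  apply: le_trans (ler_normD _ _) _; rewrite /A !mulrDl; apply: lerD; last first.
    by rewrite normrM ler_wpM2l// osc// hm lexx -[leLHS]hm mulrSr lerDl ltW.
  apply: le_trans (ler_normD _ _) _; rewrite !normrM; apply: lerD; rewrite ler_wpM2l//.
  by rewrite osc ?J1_le// ltnW.
have F2 : (A * K) ^+ 2 = (h * A ^+ 2) ^+ 2 * T j.
  rewrite /K -{2}(sqr_sqrtr T0); ring.
by rewrite -F2 lerXn2r ?nnegrE// mulr_ge0.
Qed.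

(** * Decay of the solution from a lower bound on the Euler polynomial *)

Variables (x0 x1 c : R).
Hypotheses (x01 : x0 < x1) (c_gt0 : 0 < c) (x1_le0 : x1 <= 0).
Let Q := euler_poly a0 a1 a2 h J1 m.
Hypothesis Q_ge : forall x, normc x <= expR (- x0 * h) -> c <= normc Q.[x].
(** The weight stays strictly inside the disc of radius [e^(-x0 h)] where [Q] is bounded below, as
    [conv_lower] requires. *)
Let r := expR (- x1 * h).
Let L := q%:R * r ^+ q ^+ 2.
Hypothesis small : (2 * (h * A) ^+ 2 + 2 * (h * A ^+ 2) ^+ 2 / c ^+ 2) * L <= 2^-1.
Let kappa := \sum_(i < q) normc Q`_i.

(** The square root of the bound of [absorption] for [d = 2^q D] and [d' = kappa 2^q D], with [D]
    factored out. *)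
Definition decay_const :=
  Num.sqrt (2 * (L * (1 + 2 * kappa ^+ 2 / c ^+ 2))) * 2 ^+ q.

Lemma sample_decay t : 0 <= t -> `|y t| <= decay_const * expR (x1 * t) * D.
Proof.
move=> t0.
have r1 : 1 <= r by rewrite /r -expR0 ler_expR mulr_ge0 ?oppr_ge0// ltW.
have r0 : 0 < r by exact: lt_le_trans r1.
have D0 := D_ge0.
have dD : 0 <= 2 ^+ q * D by rewrite mulr_ge0// exprn_ge0.
pose F j := normc (conv Q (fun i => (Y i)%:C) j).
have Md j : (j < q)%N -> `|M j| <= 2 ^+ q * D.
  move=> jq; rewrite ger0_norm ?cell_ge0//; apply: sup_norm_le.
    by rewrite gerBl ltW.
  by move=> u; exact: sample_growth.
have Fd j : (j < q)%N -> `|F j| <= kappa * (2 ^+ q * D).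
  move=> jq; rewrite ger0_norm ?normc_ge0//; apply: conv_bound => // i iq.
  by apply: sample_growth iq _; rewrite lexx gerBl ltW.
have YF n : c ^+ 2 * \sum_(j < n) (`|Y j| * r ^+ j) ^+ 2 <=
    \sum_(j < n) (F j * r ^+ j) ^+ 2.
  have rs : r < expR (- x0 * h) by rewrite ltr_expR ltr_pM2r// ltrN2.
  have Qn x : normc x <= expR (- x0 * h) -> Q.[x] != 0.
    move=> /Q_ge; apply: contraTneq => ->; rewrite normc0 -ltNge//.
  have Qc x : normc x = r -> c <= normc Q.[x].
    by move=> xr; apply: Q_ge; rewrite xr ltW.
  have := conv_lower (fun i => (Y i)%:C) n c_gt0 r0 rs Qn Qc.
  by under eq_bigr => j _ do rewrite normcR.
have al0 : 0 <= 2 * (h * A) ^+ 2 by rewrite mulr_ge0 ?sqr_ge0.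
have be0 : 0 <= (h * A ^+ 2) ^+ 2 by exact: sqr_ge0.
have bound := absorption r1 c_gt0 al0 be0 Md Fd cell_le residual_le YF small.
have L0 : 0 <= L by rewrite mulr_ge0 ?sqr_ge0.
have th0 : 0 <= t / h by rewrite divr_ge0// ltW.
pose k := Num.truncn (t / h).
have /andP[k1 k2] := truncn_itv th0; rewrite -/k in k1 k2.
move: k1 k2; rewrite ler_pdivlMr// ltr_pdivrMr// !mulr_natl => k1 k2.
have yM : `|y t| <= M k.+1.
  by apply: cell_ub; rewrite (ltW k2) andbT mulrSr addrK.
have MD : M k.+1 * r ^+ k.+1 <= decay_const * D.
  have C0 : 0 <= decay_const by rewrite mulr_ge0 ?sqrtr_ge0 ?exprn_ge0.
  rewrite -ler_sqr ?nnegrE ?mulr_ge0 ?cell_ge0 ?exprn_ge0 ?(ltW r0)//.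
  (* Only the term of index [k + 1] of the bounded sum is kept. *)
  apply: le_trans (le_trans (_ : _ <= \sum_(j < k.+2) (M j * r ^+ j) ^+ 2) (bound _)) _.
    by rewrite big_ord_recr/= lerDr; apply: sumr_ge0 => j _; exact: sqr_ge0.
  rewrite /decay_const !exprMn sqr_sqrtr; last first.
    by rewrite mulr_ge0// mulr_ge0// addr_ge0// divr_ge0 ?sqr_ge0// mulr_ge0 ?sqr_ge0.
  rewrite -/L le_eqVlt; apply/orP; left; apply/eqP; ring.
(* Dividing by the weight [r^(k+1)] produces the decay [e^(x1 (k+1) h)], which is at most [e^(x1 t)]
   as [x1 <= 0] and [t < (k+1) h]. *)
have re : r ^+ k.+1 * expR (x1 * (h *+ k.+1)) = 1.
  by rewrite /r -expRM_natr -expRD -mulrA mulr_natr mulNr addNr expR0.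
apply: le_trans yM _.
rewrite -[leLHS]mulr1 -re mulrA -mulrA [decay_const * _ * _]mulrAC mulrA.
apply: ler_pM => //; rewrite ?mulr_ge0 ?cell_ge0 ?exprn_ge0 ?expR_ge0 ?(ltW r0)//.
by rewrite ler_expR ler_wnM2l// ltW.
Qed.

End Sampling.

(** * Exponential stability *)

(** The window factor [q r^(2q)] is only [O(1/h)]: [q <= 5m] gives [q h <= 5 tau2], which also
    bounds the exponent of [r^(2q) = e^(-2 x1 q h)]. The coefficient [al + 2 be / c^2] in
    [absorption] is [O(h^2)], so the product is small with [h]. *)
Lemma pow_window_le (R : realType) (x1 h tau2 : R) m : x1 <= 0 -> 0 < h ->
  h *+ m = tau2 -> (0 < m)%N ->
  (2 * m + 3)%:R * expR (- x1 * h) ^+ (2 * m + 3) ^+ 2 * h <=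
  5 * tau2 * expR (- x1 * (10 * tau2)).
Proof.
move=> x1_le0 h0 hm m0.
have qh : (2 * m + 3)%:R * h <= 5 * tau2.
  rewrite -hm -[h *+ m]mulr_natl mulrA ler_pM2r// -natrM ler_nat.
  by rewrite (leq_trans (_ : _ <= 2 * m + 3 * m)%N) ?leq_add2l ?leq_pmulr// -mulnDl.
rewrite mulrAC; apply: ler_pM; rewrite ?sqr_ge0 ?mulr_ge0 ?(ltW h0)//.
rewrite -exprM -expRM_natr ler_expR -!mulrA ler_wpM2l ?oppr_ge0//.
rewrite mulrC natrM mulrAC; lra.
Qed.

Lemma exponentially_stable_of_roots (R : realType) (a0 a1 a2 tau1 tau2 x0 : R) :
  0 < tau1 -> tau1 < tau2 -> x0 < 0 ->
  (forall s, x0 <= complex.Re s -> charfun a0 a1 a2 tau1 tau2 s != 0) ->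
  exponentially_stable a0 a1 a2 tau1 tau2.
Proof.
move=> t1 t12 x0_lt0 Dn; have t2 : 0 < tau2 by exact: lt_trans t12.
(* Any rate strictly between [x0] and [0] would do: [Q] is bounded below up to the rate [x0], and
   the decay is proved at the smaller rate [x1]. *)
pose x1 := x0 / 2; have x01 : x0 < x1 by rewrite /x1; lra.
have x1_lt0 : x1 < 0 by rewrite /x1; lra.
have [c [H [c0 H0 lower]]] := euler_poly_lower (ltW t1) (ltW t12) (ltW x0_lt0) Dn.
pose A := `|a0| + `|a1| + `|a2|; have A0 : 0 <= A by rewrite !addr_ge0.
pose K := 5 * tau2 * expR (- x1 * (10 * tau2)).
have K0 : 0 <= K by rewrite mulr_ge0 ?expR_ge0// mulr_ge0// ltW.
(* [h^2 B] is the coefficient [al + 2 be / c^2] of [absorption]. *)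
pose B := 2 * A ^+ 2 + 2 * A ^+ 4 / c ^+ 2.
have B0 : 0 <= B.
  by apply: addr_ge0; [|apply: divr_ge0; rewrite ?sqr_ge0//];
    rewrite mulr_ge0 ?exprn_ge0.
(* [h S <= 1] implies at once [h <= H], [A h <= 1/2] and [h B K <= 1/2]; [m] is taken above [tau2 S]
   to ensure it. *)
pose S := H^-1 + 2 * A + 2 * (B * K).
have BK0 : 0 <= B * K by rewrite mulr_ge0.
have Hi : 0 < H^-1 by rewrite invr_gt0.
have S0 : 0 < S by rewrite /S; lra.
pose m := (Num.truncn (tau2 * S)).+1; pose h := tau2 / m%:R.
have m0 : 0 < m%:R :> R by rewrite ltr0n.
have h0 : 0 < h by rewrite divr_gt0.
have hm : h *+ m = tau2 by rewrite -mulr_natr divfK// gt_eqF.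
have hS : h * S <= 1.
  rewrite mulrAC ler_pdivrMr// mul1r.
  have /andP[_ /ltW] := truncn_itv (mulr_ge0 (ltW t2) (ltW S0)); exact.
have [hH hA hB] : [/\ h <= H, A * h <= 2^-1 & h * (B * K) <= 2^-1].
  have hi : 0 <= h * H^-1 by rewrite mulr_ge0 ?(ltW h0) ?(ltW Hi).
  have hA : 0 <= h * A by rewrite mulr_ge0 ?(ltW h0).
  have hB : 0 <= h * (B * K) by rewrite mulr_ge0 ?(ltW h0).
  have hS' : h * H^-1 + 2 * (h * A) + 2 * (h * (B * K)) <= 1.
    by apply: le_trans hS; rewrite /S le_eqVlt; apply/orP; left; apply/eqP; ring.
  split; [|by rewrite mulrC; lra|lra].
  by rewrite -[leRHS]mul1r -ler_pdivrMr//; lra.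
pose J1 := Num.truncn (tau1 / h).
have th0 : 0 <= tau1 / h by rewrite divr_ge0// ltW.
have /andP[k1 k2] := truncn_itv th0; rewrite -/J1 in k1 k2.
move: k1 k2; rewrite ler_pdivlMr// ltr_pdivrMr// !mulr_natl => k1 /ltW k2.
have Q_ge x : normc x <= expR (- x0 * h) ->
    c <= normc (euler_poly a0 a1 a2 h J1 m).[x].
  move=> hx; apply: lower hx; rewrite ?h0 ?k1//.
  by rewrite (mulrSr h m) hm lexx lerDl ltW.
have small : (2 * (h * A) ^+ 2 + 2 * (h * A ^+ 2) ^+ 2 / c ^+ 2) *
    ((2 * m + 3)%:R * expR (- x1 * h) ^+ (2 * m + 3) ^+ 2) <= 2^-1.
  have W := pow_window_le (ltW x1_lt0) h0 hm (ltn0Sn _).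
  apply: le_trans hB; rewrite [leRHS]mulrA.
  apply: le_trans (ler_wpM2l (mulr_ge0 (ltW h0) B0) W).
  by rewrite /B le_eqVlt; apply/orP; left; apply/eqP; ring.
pose C := decay_const a0 a1 a2 tau2 m J1 x1 c.
have C0 : 0 <= C by rewrite mulr_ge0 ?sqrtr_ge0 ?exprn_ge0.
(* [C] is only known to be nonnegative, hence [C + 1]. *)
exists (C + 1), (- x1); split; [by rewrite ltr_wpDl|by rewrite oppr_gt0|].
move=> phi y phic sol t t0; rewrite opprK.
have D0 := D_ge0 t1 t12 phic sol.
apply: le_trans (sample_decay t1 t12 phic sol (ltn0Sn _) k1 k2 hA x01 c0 (ltW
  x1_lt0) Q_ge small t0) _.
rewrite ler_wpM2r//; last by rewrite ler_wpM2r ?expR_ge0// lerDl.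
Qed.

Theorem theorem6 (R : realType) (a0 a1 a2 tau1 tau2 s0 : R)
    (htau1 : 0 < tau1) (htau12 : tau1 < tau2)
    (hratio : 0 < tau1 / tau2 <= 2 / 3)
    (hs0 : root_multiplicity (charfun a0 a1 a2 tau1 tau2) s0%:C 3%N) :
  strictly_dominant (charfun a0 a1 a2 tau1 tau2) s0 /\
  (s0 < 0 -> exponentially_stable a0 a1 a2 tau1 tau2).
Proof.
have dom := triple_root_dominant htau1 htau12 hs0; split=> // s0_lt0.
(* Since [s0 < s0 / 2 < 0], dominance of [s0] leaves no root with real part at least [s0 / 2]. *)
apply: (@exponentially_stable_of_roots _ _ _ _ _ _ (s0 / 2)) => //; first by lra.
move=> s hs; apply/eqP => /(proj2 dom)[e|]; last by lra.
by move: hs; rewrite e /=; lra.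
Qed.
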